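(* Let $R$ be a right coherent ring, let $\mathrm{Mod}\text{-}R$ and $\mathrm{mod}\text{-}R$ denote the categories of all, respectively finitely presented, right $R$-modules, and let $V\in\mathrm{mod}\text{-}R$. The following are equivalent: (1) $V$ is a tilting object of $\mathrm{mod}\text{-}R$; (2) there is a (possibly infinite) set $I$ such that the coproduct $V_I$ of $|I|$-many copies of $V$ in the category $\mathrm{mod}\text{-}R$ exists, $V_I$ is a classical tilting module and the torsion pair $\mathbf{t}_{V_I}:=(\mathrm{Gen}(V_I),V_I^\perp)$ in $\mathrm{Mod}\text{-}R$ restricts to $\mathrm{mod}\text{-}R$. In this case, the restricted torsion pair $(\mathrm{Gen}(V_I)\cap\mathrm{mod}\text{-}R,V_I^\perp\cap\mathrm{mod}\text{-}R)$ is the torsion pair in $\mathrm{mod}\text{-}R$ associated with $V$.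
   Context: Rings are unital and associative; $R$ right coherent means $\mathrm{mod}\text{-}R$ is an Abelian category. Sets $I$ are non-empty. Coproducts in $\mathrm{mod}\text{-}R$ (categorical coproducts in that category) may exist for infinite families and need not agree with those of $\mathrm{Mod}\text{-}R$. $\mathrm{Gen}(V_I)$ is the class of all quotients in $\mathrm{Mod}\text{-}R$ of direct sums of copies of $V_I$; $V_I^\perp=\{M\in\mathrm{Mod}\text{-}R:\mathrm{Hom}_R(V_I,M)=0\}$. A torsion pair $(\mathcal{T},\mathcal{F})$ in $\mathrm{Mod}\text{-}R$ restricts to $\mathrm{mod}\text{-}R$ if $(\mathcal{T}\cap\mathrm{mod}\text{-}R,\mathcal{F}\cap\mathrm{mod}\text{-}R)$ is a torsion pair in $\mathrm{mod}\text{-}R$. In an Abelian category $\mathcal{A}$ (in which only existing coproducts are considered): $\mathrm{Add}_{\mathcal{A}}(V)$ is the class of direct summands of coproducts of copies of $V$; $\mathrm{Gen}_{\mathcal{A}}(V)$ the class of quotients of objects of $\mathrm{Add}_{\mathcal{A}}(V)$; $\mathrm{Pres}_{\mathcal{A}}(V)$ the class of cokernels of morphisms in $\mathrm{Add}_{\mathcal{A}}(V)$; $\overline{\mathrm{Gen}}_{\mathcal{A}}(V)$ the class of subobjects of objects in $\mathrm{Gen}_{\mathcal{A}}(V)$. $V$ is a tilting object of $\mathcal{A}$ if $\mathrm{Gen}_{\mathcal{A}}(V)$ is the torsion class of a torsion pair in $\mathcal{A}$ (called the torsion pair associated with $V$), $\mathrm{Gen}_{\mathcal{A}}(V)=\mathrm{Pres}_{\mathcal{A}}(V)=\overline{\mathrm{Gen}}_{\mathcal{A}}(V)\cap\mathrm{Ker}(\mathrm{Ext}^1_{\mathcal{A}}(V,-))$,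 and every object of $\mathcal{A}$ embeds in an object of $\mathrm{Gen}_{\mathcal{A}}(V)$. A classical tilting right $R$-module is a right $R$-module $W$ such that: there is an exact sequence $0\to P_1\to P_0\to W\to 0$ with $P_0,P_1$ finitely generated projective; $\mathrm{Ext}^1_R(W,W)=0$; and there is an exact sequence $0\to R\to W_0\to W_1\to 0$ with $W_0,W_1$ direct summands of finite direct sums of copies of $W$. *)

(* Defs.v *)
From HB Require Import structures.
From mathcomp Require Import all_boot all_algebra.
From mathcomp Require Import boolp.

Set Implicit Arguments.
Unset Strict Implicit.
Unset Printing Implicit Defensive.

Import GRing.Theory.
Local Open Scope ring_scope.

Record category := Category {
  obj :> Type;
  hom : obj -> obj -> Type;
  idm : forall x, hom x x;
  cmp : forall x y z, hom y z -> hom x y -> hom x z;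
  cmp_idl : forall x y (f : hom x y), cmp (idm y) f = f;
  cmp_idr : forall x y (f : hom x y), cmp f (idm x) = f;
  cmpA : forall x y z t (h : hom z t) (g : hom y z) (f : hom x y),
    cmp h (cmp g f) = cmp (cmp h g) f
}.
Arguments hom {c} x y.
Arguments idm {c} x.
Arguments cmp {c x y z} g f.

Declare Scope cat_scope.
Notation "g '\oc' f" := (cmp g f) (at level 50, left associativity) : cat_scope.
Local Open Scope cat_scope.

Section Abelian.
Variable A : category.

Definition mono (x y : A) (f : hom x y) : Prop :=
  forall w (g h : hom w x), f \oc g = f \oc h -> g = h.

Definition epi (x y : A) (f : hom x y) : Prop :=
  forall z (g h : hom y z), g \oc f = h \oc f -> g = h.

Definition zero_obj (z : A) : Prop :=
  forall x, (exists! f : hom z x, True) /\ (exists! f : hom x z, True).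

Definition zero_mor (x y : A) (f : hom x y) : Prop :=
  exists z (g : hom z y) (h : hom x z), zero_obj z /\ f = g \oc h.

Definition is_kernel (x y k : A) (f : hom x y) (i : hom k x) : Prop :=
  zero_mor (f \oc i) /\
  forall w (g : hom w x), zero_mor (f \oc g) ->
    exists! h : hom w k, i \oc h = g.

Definition is_cokernel (x y c : A) (f : hom x y) (p : hom y c) : Prop :=
  zero_mor (p \oc f) /\
  forall w (g : hom y w), zero_mor (g \oc f) ->
    exists! h : hom c w, h \oc p = g.

Definition is_product (I : Type) (F : I -> A) (P : A)
    (pr : forall i, hom P (F i)) : Prop :=
  forall w (g : forall i, hom w (F i)),
    exists! h : hom w P, forall i, pr i \oc h = g i.

Definition is_coproduct (I : Type) (F : I -> A) (S : A)
    (inj : forall i, hom (F i) S) : Prop :=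
  forall w (g : forall i, hom (F i) w),
    exists! h : hom S w, forall i, h \oc inj i = g i.

(* Freyd's axioms; they determine a unique additive structure on the homs. *)
Definition abelian : Prop :=
  (exists z : A, zero_obj z) /\
  (forall x y : A, exists P (pr : forall b : bool, hom P (if b then x else y)),
      is_product pr) /\
  (forall x y : A, exists S (inj : forall b : bool, hom (if b then x else y) S),
      is_coproduct inj) /\
  (forall (x y : A) (f : hom x y), exists k (i : hom k x), is_kernel f i) /\
  (forall (x y : A) (f : hom x y), exists c (p : hom y c), is_cokernel f p) /\
  (forall (x y : A) (i : hom x y), mono i ->
      exists z (f : hom y z), is_kernel f i) /\
  (forall (x y : A) (p : hom x y), epi p ->
      exists z (f : hom z x), is_cokernel f p).

Definition short_exact (x y z : A) (i : hom x y) (p : hom y z) : Prop :=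
  is_kernel p i /\ is_cokernel i p.

(* Ext^1 is taken in the sense of Yoneda. *)
Record extension (c a : A) := Extension {
  ext_obj : A;
  ext_inj : hom a ext_obj;
  ext_proj : hom ext_obj c;
  ext_exact : short_exact ext_inj ext_proj
}.

Definition ext_equiv (c a : A) (E E' : extension c a) : Prop :=
  exists h : hom (ext_obj E) (ext_obj E'),
    h \oc ext_inj E = ext_inj E' /\ ext_proj E' \oc h = ext_proj E.

(* Ext^1(c, a) = 0: there is only one class, namely that of the split
   extension. *)
Definition Ext1_zero (c a : A) : Prop :=
  forall E E' : extension c a, ext_equiv E E'.

Definition summand (s x : A) : Prop :=
  exists s' (inj : forall b : bool, hom (if b then s else s') x),
    is_coproduct inj.

Definition is_copower (I : Type) (v x : A) : Prop :=
  exists inj : I -> hom v x, is_coproduct (F := fun _ : I => v) inj.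

Definition Add (v x : A) : Prop :=
  exists (I : Type) (c : A), inhabited I /\ is_copower I v c /\ summand x c.

Definition Gen (v x : A) : Prop :=
  exists (y : A) (p : hom y x), Add v y /\ epi p.

Definition Pres (v x : A) : Prop :=
  exists (y1 y0 : A) (f : hom y1 y0) (p : hom y0 x),
    Add v y1 /\ Add v y0 /\ is_cokernel f p.

Definition Gen_bar (v x : A) : Prop :=
  exists (y : A) (i : hom x y), Gen v y /\ mono i.

(* For A = Mod-R this is Gen(v): the quotients of direct sums of copies of v,
   without passing to direct summands first. *)
Definition quot_copowers (v x : A) : Prop :=
  exists (I : Type) (c : A) (p : hom c x),
    inhabited I /\ is_copower I v c /\ epi p.

Definition perp (v x : A) : Prop := forall f : hom v x, zero_mor f.

Definition torsion_pair (T F : A -> Prop) : Prop :=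
  (forall x, T x <-> (forall y, F y -> forall f : hom x y, zero_mor f)) /\
  (forall y, F y <-> (forall x, T x -> forall f : hom x y, zero_mor f)) /\
  (forall m, exists t f (i : hom t m) (p : hom m f),
      T t /\ F f /\ short_exact i p).

Definition tilting_object (v : A) : Prop :=
  (exists F : A -> Prop, torsion_pair (Gen v) F) /\
  (forall x, Gen v x <-> Pres v x) /\
  (forall x, Gen v x <-> (Gen_bar v x /\ Ext1_zero v x)) /\
  (forall x, exists (y : A) (i : hom x y), Gen v y /\ mono i).

Definition associated_torsion_pair (v : A) (T F : A -> Prop) : Prop :=
  torsion_pair T F /\ (forall x, T x <-> Gen v x).

Definition projective (p : A) : Prop :=
  forall (x y : A) (e : hom x y) (f : hom p y), epi e ->
    exists g : hom p x, e \oc g = f.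

End Abelian.

Section FullSubcategory.
Variables (A : category) (P : A -> Prop).

Definition full_subcat : category :=
  @Category {x : A | P x} (fun x y => hom (sval x) (sval y))
    (fun x => idm (sval x)) (fun x y z g f => g \oc f)
    (fun x y f => cmp_idl f) (fun x y f => cmp_idr f)
    (fun x y z t h g f => cmpA h g f).

End FullSubcategory.

Section Modules.
Variable R : pzRingType.

Lemma linear_ext (U W : lmodType R^c) (f g : {linear U -> W}) :
  (f : U -> W) = g -> f = g.
Proof.
case: f => f [[f1] [f2]]; case: g => g [[g1] [g2]] /= efg.
by case: g / efg g1 g2 => g1 g2; rewrite (Prop_irrelevance f1 g1)
  (Prop_irrelevance f2 g2).
Qed.

(* Right R-modules are left modules over the converse ring R^c. *)
Definition Mod : category :=
  @Category (lmodType R^c) (fun U W => {linear U -> W})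
    (fun U => idfun : {linear U -> U})
    (fun U W X g f => (g \o f : {linear U -> X}))
    (fun U W f => @linear_ext U W (idfun \o f) f (erefl _))
    (fun U W f => @linear_ext U W (f \o idfun) f (erefl _))
    (fun U W X Y h g f =>
       @linear_ext U Y (h \o (g \o f)) ((h \o g) \o f) (erefl _)).

Definition regular_module : Mod := (R^c)^o.

Definition finitely_generated (M : Mod) : Prop :=
  exists (n : nat) (g : {linear 'rV[R^c]_n -> M}), forall y, exists x, g x = y.

(* R^m -> R^n -> M -> 0 exact *)
Definition finitely_presented (M : Mod) : Prop :=
  exists (m n : nat) (f : {linear 'rV[R^c]_m -> 'rV[R^c]_n})
         (g : {linear 'rV[R^c]_n -> M}),
    (forall y, exists x, g x = y) /\
    (forall x, g x = 0 <-> exists w, f w = x).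

Definition fpMod : category := full_subcat finitely_presented.

Definition fp_module (M : fpMod) : Mod := sval M.

Definition right_coherent : Prop := abelian fpMod.

Definition restrict_fp (T : Mod -> Prop) : fpMod -> Prop :=
  fun M => T (fp_module M).

Definition torsion_pair_restricts (T F : Mod -> Prop) : Prop :=
  torsion_pair T F /\ torsion_pair (restrict_fp T) (restrict_fp F).

Definition add_fin (W M : Mod) : Prop :=
  exists (n : nat) (C : Mod), is_copower 'I_n W C /\ summand M C.

Definition classical_tilting (W : Mod) : Prop :=
  (exists (P1 P0 : Mod) (i : hom P1 P0) (p : hom P0 W),
      finitely_generated P1 /\ projective P1 /\
      finitely_generated P0 /\ projective P0 /\ short_exact i p) /\
  Ext1_zero W W /\
  (exists (W0 W1 : Mod) (i : hom regular_module W0) (p : hom W0 W1),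
      add_fin W W0 /\ add_fin W W1 /\ short_exact i p).

Definition classical_tilting_coproduct (V : fpMod) (I : Type) (VI : fpMod) :
    Prop :=
  inhabited I /\ is_copower I V VI /\
  classical_tilting (fp_module VI) /\
  torsion_pair_restricts (quot_copowers (fp_module VI)) (perp (fp_module VI)).

End Modules.

(* Main.v *)
(** Monomorphisms, epimorphisms and short exact sequences in mod-R are those of
    Mod-R, because R is a finitely presented generator and mod-R is closed under
    kernels, cokernels and extensions.  A coproduct V_I of copies of V in mod-R
    satisfies Ext^1(V_I, X) = 0 as soon as Ext^1(V, X) = 0.

    If V is tilting in mod-R, then Gen V = Ker Ext^1(V, -) on mod-R, as every
    object embeds in Gen V.  Embed R in some Y in Add V with cokernel C in Gen V,
    choose Y0 -> C onto with Y0 in Add V and kernel K in Gen V, and let P be the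
    pullback of Y -> C <- Y0.  Then 0 -> K -> P -> Y -> 0 splits, so P is in
    Gen V, and 0 -> R -> P -> Y0 -> 0 gives Ext^1(P, Gen V) = 0, so P is in Add V.
    Any coproduct V_I having P and Y0 as summands is a classical tilting module.

    Conversely, if W = V_I is classical tilting, then Gen W = Ker Ext^1(W, -).
    For X finitely presented in Gen W, take W' -> X onto with W' in add W and
    kernel K, and embed K in L in Gen W with cokernel in add W; the pushout Q of
    L <- K -> W' is in add W, and 0 -> L -> Q -> X -> 0 shows X in Pres V. *)

Require Import Defs.
From HB Require Import structures.
From mathcomp Require Import all_boot all_algebra.
From mathcomp Require Import boolp.

Set Implicit Arguments.
Unset Strict Implicit.
Unset Printing Implicit Defensive.

Import GRing.Theory.
Local Open Scope ring_scope.

Definition surj (A B : Type) (f : A -> B) := forall b, exists a, f a = b.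

(* Module operations satisfying the axioms only up to a congruence.  Submodules,
   quotient modules and direct sums are all obtained as quotients of these. *)
Record premodule (S : pzRingType) := Premodule {
  pm_sort : Type;
  pm_eq : pm_sort -> pm_sort -> Prop;
  pm_zero : pm_sort;
  pm_opp : pm_sort -> pm_sort;
  pm_add : pm_sort -> pm_sort -> pm_sort;
  pm_scale : S -> pm_sort -> pm_sort;
  pm_refl : forall x, pm_eq x x;
  pm_sym : forall x y, pm_eq x y -> pm_eq y x;
  pm_trans : forall x y z, pm_eq x y -> pm_eq y z -> pm_eq x z;
  pm_oppW : forall x y, pm_eq x y -> pm_eq (pm_opp x) (pm_opp y);
  pm_addW : forall x y z t, pm_eq x y -> pm_eq z t ->
    pm_eq (pm_add x z) (pm_add y t);
  pm_scaleW : forall a x y, pm_eq x y -> pm_eq (pm_scale a x) (pm_scale a y);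
  pm_addA : forall x y z,
    pm_eq (pm_add x (pm_add y z)) (pm_add (pm_add x y) z);
  pm_addC : forall x y, pm_eq (pm_add x y) (pm_add y x);
  pm_add0 : forall x, pm_eq (pm_add pm_zero x) x;
  pm_addN : forall x, pm_eq (pm_add (pm_opp x) x) pm_zero;
  pm_scaleA : forall a b x,
    pm_eq (pm_scale a (pm_scale b x)) (pm_scale (a * b) x);
  pm_scale1 : forall x, pm_eq (pm_scale 1 x) x;
  pm_scaleDr : forall a x y,
    pm_eq (pm_scale a (pm_add x y)) (pm_add (pm_scale a x) (pm_scale a y));
  pm_scaleDl : forall x a b,
    pm_eq (pm_scale (a + b) x) (pm_add (pm_scale a x) (pm_scale b x))
}.

(** * Quotients of premodules *)

Section PremoduleQuotient.
Variables (S : pzRingType) (p : premodule S).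
Local Notation T := (pm_sort p).
Local Notation E := (@pm_eq S p).

(** Choosing from the predicate [E x] makes the representative depend on the class only: by
    extensionality, congruent elements define equal predicates. The quotient can then be the type of
    fixed points of [pm_repr]. *)
Definition pm_repr (x : T) : T := sval (cid (ex_intro (E x) x (pm_refl x))).

Lemma pm_reprE x : E x (pm_repr x).
Proof. exact: svalP (cid _). Qed.

Lemma pm_repr_eq x y : E x y -> pm_repr x = pm_repr y.
Proof.
move=> xy; have eE : E x = E y.
  apply/funext => z; apply/propext.
  by split=> ?; [apply: pm_trans (pm_sym xy) _|apply: pm_trans xy _].
have cid_ext (P Q : T -> Prop) (hP : exists z, P z) (hQ : exists z, Q z) :
    P = Q -> sval (cid hP) = sval (cid hQ).
  by move=> ePQ; subst Q; rewrite (Prop_irrelevance hP hQ).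
exact: cid_ext.
Qed.

Definition pm_quot := {x : T | pm_repr x = x}.

Definition pm_pi (x : T) : pm_quot :=
  exist _ (pm_repr x) (esym (pm_repr_eq (pm_reprE x))).

Lemma pm_piP x y : E x y <-> pm_pi x = pm_pi y.
Proof.
split=> [/pm_repr_eq xy|/(congr1 sval) /= xy].
  by apply: eq_exist.
by apply: pm_trans (pm_reprE x) _; rewrite xy; exact/pm_sym/pm_reprE.
Qed.

Lemma pm_piK (q : pm_quot) : pm_pi (sval q) = q.
Proof. by case: q => x rx; apply: eq_exist. Qed.

HB.instance Definition _ := gen_eqMixin pm_quot.
HB.instance Definition _ := gen_choiceMixin pm_quot.

Let zero := pm_pi (@pm_zero S p).
Let opp (q : pm_quot) := pm_pi (pm_opp (sval q)).
Let add (q r : pm_quot) := pm_pi (pm_add (sval q) (sval r)).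
Let scale a (q : pm_quot) := pm_pi (pm_scale a (sval q)).

Let oppE x : pm_pi (pm_opp x) = opp (pm_pi x).
Proof. exact/pm_piP/pm_oppW/pm_reprE. Qed.
Let addE x y : pm_pi (pm_add x y) = add (pm_pi x) (pm_pi y).
Proof. by apply/pm_piP/pm_addW; exact: pm_reprE. Qed.
Let scaleE a x : pm_pi (pm_scale a x) = scale a (pm_pi x).
Proof. exact/pm_piP/pm_scaleW/pm_reprE. Qed.

Let qaddA : associative add.
Proof.
move=> q r s; rewrite -(pm_piK q) -(pm_piK r) -(pm_piK s) -!addE.
exact/pm_piP/pm_addA.
Qed.
Let qaddC : commutative add.
Proof. by move=> q r; exact/pm_piP/pm_addC. Qed.
Let qadd0 : left_id zero add.
Proof. by move=> q; rewrite -(pm_piK q) -addE; exact/pm_piP/pm_add0. Qed.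
Let qaddN : left_inverse zero opp add.
Proof. by move=> q; rewrite -(pm_piK q) -oppE -addE; exact/pm_piP/pm_addN. Qed.

HB.instance Definition _ := GRing.isZmodule.Build pm_quot qaddA qaddC qadd0 qaddN.

Let piD x y : pm_pi (pm_add x y) = pm_pi x + pm_pi y.
Proof. exact: addE. Qed.

Let qscaleA a b q : scale a (scale b q) = scale (a * b) q.
Proof. by rewrite -(pm_piK q) -!scaleE; exact/pm_piP/pm_scaleA. Qed.
Let qscale1 : left_id 1 scale.
Proof. by move=> q; rewrite -(pm_piK q) -scaleE; exact/pm_piP/pm_scale1. Qed.
Let qscaleDr : right_distributive scale +%R.
Proof.
move=> a q r; rewrite -(pm_piK q) -(pm_piK r) -piD -!scaleE -piD.
exact/pm_piP/pm_scaleDr.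
Qed.
Let qscaleDl q : {morph scale^~ q : a b / a + b}.
Proof.
by move=> a b; rewrite -(pm_piK q) -!scaleE -piD; exact/pm_piP/pm_scaleDl.
Qed.

HB.instance Definition _ :=
  GRing.Zmodule_isLmodule.Build S pm_quot qscaleA qscale1 qscaleDr qscaleDl.

(** The interface through which all later constructions see the quotient; its carrier is hidden from
    here on. *)
Lemma premodule_quotient : exists (Q : lmodType S) (pi : T -> Q),
  [/\ surj pi, forall x y, pi x = pi y <-> E x y,
      forall x y, pi (pm_add x y) = pi x + pi y
    & forall a x, pi (pm_scale a x) = a *: pi x].
Proof.
exists pm_quot, pm_pi; split.
- by move=> q; exists (sval q); exact: pm_piK.
- by move=> x y; split=> /pm_piP.
- exact: addE.
- exact: scaleE.
Qed.

End PremoduleQuotient.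

(** * Modules *)

Section Modules.
Variable R : pzRingType.
Local Notation S := (R^c).
Implicit Types A B C D E F K L M N P Q T W X Y Z : lmodType S.

Lemma linear_of A B (f : A -> B) :
  linear f -> exists g : {linear A -> B}, forall x, g x = f x.
Proof.
by move=> lf; exists (HB.pack_for {linear A -> B} f
  (GRing.isLinear.Build _ _ _ _ _ lf)).
Qed.

Lemma linear_inj A B (f : {linear A -> B}) :
  (forall x, f x = 0 -> x = 0) -> injective f.
Proof. exact: raddf_inj. Qed.

(** Choice gives a set-theoretic section of [q]; composed with [f] it is linear, because [f] is
    constant on the fibres of [q]. *)
Lemma factor_surj A B C (q : {linear A -> B}) (f : {linear A -> C}) :
  surj q -> (forall a, q a = 0 -> f a = 0) ->
  exists g : {linear B -> C}, forall a, g (q a) = f a.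
Proof.
move=> sq kf; have [s sK] := choice sq.
have fs a b : q a = q b -> f a = f b.
  move=> e; apply/eqP; rewrite -subr_eq0 -linearB; apply/eqP/kf.
  by rewrite linearB e subrr.
have [|g gE] := @linear_of B C (f \o s).
  by move=> c x y /=; rewrite -linearP; apply: fs; rewrite linearP !sK.
by exists g => a; rewrite gE /=; apply: fs; rewrite sK.
Qed.

Lemma factor_inj A B C (i : {linear A -> B}) (f : {linear C -> B}) :
  injective i -> (forall c, exists a, i a = f c) ->
  exists g : {linear C -> A}, forall c, i (g c) = f c.
Proof.
move=> inji imf; have [s sK] := choice imf.
have [|g gE] := @linear_of C A s; last by exists g => c; rewrite gE.
by move=> c x y; apply: inji; rewrite linearP !sK linearP.
Qed.

Lemma prod_map A B C (f : {linear C -> A}) (g : {linear C -> B}) :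
  exists h : {linear C -> (A * B)%type}, forall c, h c = (f c, g c).
Proof. by apply: linear_of => a x y; rewrite !linearP. Qed.

(** * Submodules, quotient modules and direct sums *)

Definition submod M (N : M -> Prop) :=
  N 0 /\ forall a x y, N x -> N y -> N (a *: x + y).

Lemma submod_inj M (N : M -> Prop) : submod N ->
  exists (K : lmodType S) (i : {linear K -> M}),
    injective i /\ forall x, N x <-> exists k, i k = x.
Proof.
case=> N0 NP.
have ND x y : N x -> N y -> N (x + y).
  by move=> Nx Ny; rewrite -(scale1r x); apply: NP.
have NZ a x : N x -> N (a *: x).
  by move=> Nx; rewrite -[_ *: _]addr0; apply: NP.
have NN x : N x -> N (- x) by move=> Nx; rewrite -scaleN1r; apply: NZ.
pose T := {x : M | N x}.
pose add (x y : T) : T :=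
  exist _ (sval x + sval y) (ND _ _ (svalP x) (svalP y)).
pose opp (x : T) : T := exist _ (- sval x) (NN _ (svalP x)).
pose scale a (x : T) : T := exist _ (a *: sval x) (NZ a _ (svalP x)).
(* Congruence is equality of the underlying elements, so membership proofs are never compared. *)
unshelve epose (p := @Premodule S T (fun x y => sval x = sval y)
    (exist _ 0 N0) opp add scale
    (fun=> erefl) _ _ _ _ _ _ _ _ _ _ _ _ _).
- by [].
- by move=> x y z /= ->.
- by move=> x y /= ->.
- by move=> x y z t /= -> ->.
- by move=> a x y /= ->.
- by move=> x y z; exact: addrA.
- by move=> x y; exact: addrC.
- by move=> x; exact: add0r.
- by move=> x; exact: addNr.
- by move=> a b x; exact: scalerA.
- by move=> x; exact: scale1r.
- by move=> a x y; exact: scalerDr.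
- by move=> x a b; exact: scalerDl.
have [Q [pi [spi piE piD piZ]]] := premodule_quotient p.
have [s sK] := choice spi.
have svalpi t : sval (s (pi t)) = sval t by apply/piE; rewrite sK.
have [|i iE] := @linear_of Q M (fun q => sval (s q)).
  move=> a x y; rewrite -{1}(sK x) -{1}(sK y) -piZ -piD svalpi.
  by rewrite /=.
exists Q, i; split=> [x y|x].
  by rewrite !iE => e; rewrite -(sK x) -(sK y); apply/piE.
split=> [Nx|[k <-]]; last by rewrite iE; exact: svalP.
by exists (pi (exist _ x Nx)); rewrite iE svalpi.
Qed.

Lemma submod_quot M (N : M -> Prop) : submod N ->
  exists (Q : lmodType S) (q : {linear M -> Q}),
    surj q /\ forall x, q x = 0 <-> N x.
Proof.
case=> N0 NP.
have ND x y : N x -> N y -> N (x + y).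
  by move=> Nx Ny; rewrite -(scale1r x); apply: NP.
have NZ a x : N x -> N (a *: x).
  by move=> Nx; rewrite -[_ *: _]addr0; apply: NP.
have NN x : N x -> N (- x) by move=> Nx; rewrite -scaleN1r; apply: NZ.
have Neq x y : x = y -> N (x - y) by move=> ->; rewrite subrr.
unshelve epose (p := @Premodule S M (fun x y => N (x - y)) 0 -%R +%R *:%R
  (fun x => Neq _ _ erefl) _ _ _ _ _ (fun x y z => Neq _ _ (addrA x y z))
  (fun x y => Neq _ _ (addrC x y)) (fun x => Neq _ _ (add0r x))
  (fun x => Neq _ _ (addNr x)) (fun a b x => Neq _ _ (scalerA a b x))
  (fun x => Neq _ _ (scale1r x)) (fun a x y => Neq _ _ (scalerDr a x y))
  (fun x a b => Neq _ _ (scalerDl x a b))).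
- by move=> x y /NN; rewrite opprB.
- by move=> x y z /ND h /h; rewrite addrA subrK.
- by move=> x y /NN; rewrite opprB opprK addrC.
- by move=> x y z t /= xy zt; rewrite opprD addrACA; apply: ND.
- by move=> a x y /= xy; rewrite -scalerBr; apply: NZ.
have [Q [pi [spi piE piD piZ]]] := premodule_quotient p.
rewrite /= in pi spi piE piD piZ.
have [|q qE] := @linear_of M Q pi; first by move=> a x y; rewrite -piZ -piD.
have pi0 : pi 0 = 0 by rewrite -qE linear0.
exists Q, q; split=> [b|x]; first by have [x <-] := spi b; exists x.
by rewrite qE -pi0 piE subr0.
Qed.

Lemma copower_exists (I : Type) M :
  exists (C : lmodType S) (inj : I -> {linear M -> C}),
  forall N (g : I -> {linear M -> N}), exists! h : {linear C -> N},
    forall i x, h (inj i x) = g i x.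
Proof.
(* The direct sum: formal sums of pairs (i, x), identified when every family of
   maps out of the copies of M evaluates them equally. *)
pose T := seq (I * M)%type.
pose ev N (g : I -> {linear M -> N}) (s : T) := \sum_(u <- s) g u.1 u.2.
pose E s t := forall N g, @ev N g s = ev N g t.
have evD N g s t : ev N g (s ++ t) = ev N g s + ev N g t by exact: big_cat.
pose sc a (s : T) : T := [seq (u.1, a *: u.2) | u <- s].
have evZ N g a s : ev N g (sc a s) = a *: ev N g s.
  by rewrite /ev big_map scaler_sumr; apply: eq_bigr => u _; rewrite linearZ.
unshelve epose (p := @Premodule S T E [::] (sc (-1)) cat sc
    _ _ _ _ _ _ _ _ _ _ _ _ _ _); rewrite /E //.
- by move=> s t u st tu N g; rewrite st.
- by move=> s t st N g; rewrite !evZ st.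
- by move=> s t u v st uv N g; rewrite !evD st uv.
- by move=> a s t st N g; rewrite !evZ st.
- by move=> s t u N g; rewrite catA.
- by move=> s t N g; rewrite !evD addrC.
- by move=> s N g; rewrite evD evZ scaleN1r addNr /ev big_nil.
- by move=> a b s N g; rewrite !evZ scalerA.
- by move=> s N g; rewrite evZ scale1r.
- by move=> a s t N g; rewrite !(evZ, evD) scalerDr.
- by move=> s a b N g; rewrite !(evZ, evD) scalerDl.
have [Q [pi [spi piE piD piZ]]] := premodule_quotient p.
rewrite /= in pi spi piE piD piZ.
have /choice[inj injE] (i : I) : exists f : {linear M -> Q},
    forall x, f x = pi [:: (i, x)].
  apply: linear_of => a x y; rewrite -piZ -piD; apply: (piE _ _).2 => N g.
  by rewrite evD evZ /ev !big_seq1 /= linearP.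
exists Q, inj => N g; have [s sK] := choice spi.
have evs t : ev N g (s (pi t)) = ev N g t by apply: (piE _ _).1; rewrite sK.
have [|h hE] := @linear_of Q N (fun q => ev N g (s q)).
  move=> a x y.
  by rewrite -{1}(sK x) -{1}(sK y) -piZ -piD evs evD evZ.
exists h; split=> [i x|h' h'E].
  by rewrite hE injE evs /ev big_seq1.
(* Uniqueness: every class is a finite sum of values of the coprojections, by induction on the
   formal sum. *)
apply: linear_ext; apply/funext => q; rewrite -(sK q) hE evs.
elim: (s q) => [|[i x] t IH].
  have ->: pi [::] = 0.
    by rewrite -(scale0r (pi [::])) -piZ.
  by rewrite linear0 /ev big_nil.
have ->: pi ((i, x) :: t) = inj i x + pi t by rewrite injE -piD.
by rewrite linearD h'E -IH /ev big_cons.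
Qed.

(** * Short exact sequences, pushouts, pullbacks and splitting of extensions *)

Definition ses A E C (i : {linear A -> E}) (p : {linear E -> C}) :=
  [/\ injective i, surj p & forall x, p x = 0 <-> exists a, i a = x].

(* Ext^1(C, A) = 0 *)
Definition ext_split C A := forall E (i : {linear A -> E}) (p : {linear E -> C}),
  ses i p -> exists s : {linear C -> E}, forall c, p (s c) = c.

Definition lifting P := forall A B (e : {linear A -> B}) (f : {linear P -> B}),
  surj e -> exists g : {linear P -> A}, forall x, e (g x) = f x.

Lemma ses_retraction A E C (i : {linear A -> E}) (p : {linear E -> C})
    (s : {linear C -> E}) : ses i p -> (forall c, p (s c) = c) ->
  exists r : {linear E -> A},
    (forall a, r (i a) = a) /\ forall x, i (r x) = x - s (p x).
Proof.
case=> inji _ ex sK.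
have [x|r rE] := @factor_inj A E E i (idfun \- (s \o p)) inji.
  by apply/ex; rewrite /= linearB sK subrr.
exists r; split=> [a|x]; last by rewrite rE.
apply: inji; rewrite rE /=; have -> : p (i a) = 0 by apply/ex; exists a.
by rewrite linear0 subr0.
Qed.

Lemma cokernel_exists A B (f : {linear A -> B}) :
  exists C (p : {linear B -> C}),
    surj p /\ forall b, p b = 0 <-> exists a, f a = b.
Proof.
apply: submod_quot; split=> [|c _ _ [x <-] [y <-]].
  by exists 0; rewrite linear0.
by exists (c *: x + y); rewrite linearP.
Qed.

Lemma ses_cokernel A B (i : {linear A -> B}) : injective i ->
  exists C (p : {linear B -> C}), ses i p.
Proof. by move=> inji; have [C [p [sp pE]]] := cokernel_exists i; exists C, p. Qed.

Lemma ses_prod A E C A' E' C' (i : {linear A -> E}) (p : {linear E -> C})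
    (i' : {linear A' -> E'}) (p' : {linear E' -> C'}) :
  ses i p -> ses i' p' ->
  exists (j : {linear (A * A')%type -> (E * E')%type})
    (q : {linear (E * E')%type -> (C * C')%type}), ses j q.
Proof.
move=> [inji sp ex] [inji' sp' ex'].
have [j jE] := prod_map (i \o fst) (i' \o snd).
have [q qE] := prod_map (p \o fst) (p' \o snd).
exists j, q; split.
- by move=> [a a'] [b b']; rewrite !jE /= => -[/inji -> /inji' ->].
- move=> [c c']; have [[e <-] [e' <-]] := (sp c, sp' c').
  by exists (e, e'); rewrite qE.
- move=> [e e']; rewrite qE /=; split=> [[/ex [a <-] /ex' [a' <-]]|].
    by exists (a, a'); rewrite jE.
  case=> [[a a']]; rewrite jE /= => -[<- <-].
  by congr (_, _); [apply/ex; exists a|apply/ex'; exists a'].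
Qed.

Lemma pair_split A B (x : A) (y : B) : ((x, 0) : (A * B)%type) + (0, y) = (x, y).
Proof. exact: congr2 (addr0 x) (add0r y). Qed.

(** The pushout is F x A modulo the antidiagonal image of K. The last clause gives the second exact
    sequence of the pushout square when [f] is injective with cokernel [q]. *)
Lemma pushout_ses K F C A (i : {linear K -> F}) (p : {linear F -> C})
    (f : {linear K -> A}) : ses i p ->
  exists Q (u : {linear F -> Q}) (v : {linear A -> Q}) (p' : {linear Q -> C}),
  [/\ ses v p', forall k, u (i k) = v (f k),
      forall z, exists x a, z = u x + v a
    & forall D (q : {linear A -> D}), ses f q ->
        exists q' : {linear Q -> D}, ses u q'].
Proof.
move=> [inji sp ex].
have [|Q [q [sq qE]]] := @submod_quot (F * A)%type
    (fun x => exists k, x = (i k, - f k)).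
  split=> [|a _ _ [k ->] [l ->]]; first by exists 0; rewrite !linear0.
  by exists (a *: k + l); rewrite !linearP.
have [inl inlE] := @prod_map F A F idfun \0.
have [inr inrE] := @prod_map F A A \0 idfun.
pose u : {linear F -> Q} := q \o inl; pose v : {linear A -> Q} := q \o inr.
have uvE x a : u x + v a = q (x, a).
  by rewrite /u /v /= -linearD inlE inrE /= pair_split.
have uv0 (x : F) (a : A) : u x + v a = 0 <-> exists k, x = i k /\ a = - f k.
  rewrite uvE qE; split=> [[k [-> ->]]|[k [-> ->]]]; by exists k.
have quv (z : Q) : exists x a, z = u x + v a.
  by have [[x a] <-] := sq z; exists x, a; rewrite uvE.
(* Both maps out of Q come from this universal property: [p'] from the pair (p, 0), and the map onto
   D from the pair (0, r). *)
have factor Z (g : {linear F -> Z}) (h : {linear A -> Z}) :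
    (forall k, g (i k) = h (f k)) -> exists w : {linear Q -> Z},
    forall x a, w (u x + v a) = g x + h a.
  move=> gh; have [|w wE] := @factor_surj _ _ _ q
    ((g \o fst) \+ (h \o snd)) sq.
    by move=> x /qE [k ->] /=; rewrite linearN gh subrr.
  by exists w => x a; rewrite uvE wE.
have uvk k : u (i k) = v (f k).
  apply/eqP; rewrite -subr_eq0 -linearN; apply/eqP/uv0; by exists k.
have [|p' p'E] := factor C p \0.
  by move=> k; apply/ex; exists k.
exists Q, u, v, p'; split=> //.
- split.
  + apply: linear_inj => a va0.
    have /uv0 [k [k0 ->]] : u 0 + v a = 0 by rewrite linear0 add0r.
    have -> : k = 0 by apply: inji; rewrite -k0 linear0.
    by rewrite linear0 oppr0.
  + by move=> c; have [x <-] := sp c; exists (u x + v 0); rewrite p'E addr0.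
  + move=> z; split=> [|[a <-]].
      have [x [a ->]] := quv z; rewrite p'E addr0 => /ex [k <-].
      by exists (f k + a); rewrite linearD uvk.
    by have := p'E 0 a; rewrite !linear0 !add0r.
- move=> D r [injf sr exr]; have [|r' r'E] := factor D \0 r.
    by move=> k; apply/esym/exr; exists k.
  exists r'; split.
  + apply: linear_inj => x ux0.
    have /uv0 [k [-> /esym/eqP]] : u x + v 0 = 0 by rewrite linear0 addr0.
    rewrite oppr_eq0 => /eqP fk0; have -> : k = 0.
      by apply: injf; rewrite fk0 linear0.
    by rewrite linear0.
  + by move=> d; have [a <-] := sr d; exists (u 0 + v a); rewrite r'E add0r.
  + move=> z; split=> [|[x <-]].
      have [x [a ->]] := quv z; rewrite r'E add0r => /exr [k <-].
      by exists (x + i k); rewrite linearD uvk.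
    by have := r'E x 0; rewrite !linear0 !addr0.
Qed.

(** Dually, the pullback is the submodule of E x C on which the two maps to X agree. *)
Lemma pullback_ses A E X C (i : {linear A -> E}) (p : {linear E -> X})
    (f : {linear C -> X}) : ses i p ->
  exists P (a : {linear P -> E}) (b : {linear P -> C}) (i' : {linear A -> P}),
  [/\ ses i' b, forall x, p (a x) = f (b x)
    & forall B (j : {linear B -> C}), ses j f ->
        exists j' : {linear B -> P}, ses j' a].
Proof.
move=> [inji sp ex].
have [|P [k [injk kE]]] := @submod_inj (E * C)%type (fun x => p x.1 = f x.2).
  split=> [|c [x x'] [y y'] /= xE yE]; first by rewrite !linear0.
  by rewrite !linearP xE yE.
pose a : {linear P -> E} := fst \o k; pose b : {linear P -> C} := snd \o k.
have kab x : k x = (a x, b x) by rewrite /a /b /=; case: (k x).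
have abE x : p (a x) = f (b x) by apply/kE; exists x.
have ab_ex e c : p e = f c -> exists x, a x = e /\ b x = c.
  by move=> pf; have [x xE] := (kE (e, c)).1 pf; exists x; rewrite /a /b /= xE.
have ab_inj x y : a x = a y -> b x = b y -> x = y.
  by move=> xa xb; apply: injk; rewrite !kab xa xb.
have ab_map Z (g : {linear Z -> E}) (h : {linear Z -> C}) :
    (forall z, p (g z) = f (h z)) -> exists w : {linear Z -> P},
    forall z, a (w z) = g z /\ b (w z) = h z.
  move=> gh; have [l lE] := prod_map g h.
  have [z|w wE] := @factor_inj _ _ _ k l injk; first by apply/kE; rewrite lE /= gh.
  by exists w => z; rewrite /a /b /= wE lE.
have [z|i' i'E] := ab_map A i \0; first by rewrite linear0; apply/ex; exists z.
exists P, a, b, i'; split=> //.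
- split.
  + by move=> x y xy; apply: inji; rewrite -(i'E x).1 -(i'E y).1 xy.
  + move=> c; have [e eE] := sp (f c); have [x [_ <-]] := ab_ex _ _ eE.
    by exists x.
  + move=> x; split=> [bx0|[y <-]]; last by rewrite (i'E y).2.
    have /ex [y yE] : p (a x) = 0 by rewrite abE bx0 linear0.
    by exists y; apply: ab_inj; rewrite ?(i'E y).1 ?(i'E y).2.
- move=> B j [injj sf exj].
  have [z|j' j'E] := ab_map B \0 j.
    by rewrite linear0; apply/esym/exj; exists z.
  exists j'; split.
  + by move=> x y xy; apply: injj; rewrite -(j'E x).2 -(j'E y).2 xy.
  + move=> e; have [c cE] := sf (p e).
    by have [x [<- _]] := ab_ex _ _ (esym cE); exists x.
  + move=> x; split=> [ax0|[y <-]]; last by rewrite (j'E y).1.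
    have /exj [y yE] : f (b x) = 0 by rewrite -abE ax0 linear0.
    by exists y; apply: ab_inj; rewrite ?(j'E y).1 ?(j'E y).2.
Qed.

(** Pull the extension back along [f], split the result, and compose the section with the projection
    to E. *)
Lemma ext_split_lift A E X C (i : {linear A -> E}) (p : {linear E -> X})
    (f : {linear C -> X}) : ext_split C A -> ses i p ->
  exists g : {linear C -> E}, forall c, p (g c) = f c.
Proof.
move=> xs sip; have [P [a [b [i' [sib ab _]]]]] := pullback_ses f sip.
have [s sK] := xs _ _ _ sib.
by exists (a \o s) => c /=; rewrite ab sK.
Qed.

(** Push the extension out along [f]; a retraction onto A, composed with the map from F, extends
    [f]. *)
Lemma ext_split_extend K F C A (i : {linear K -> F}) (p : {linear F -> C})
    (f : {linear K -> A}) : ext_split C A -> ses i p ->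
  exists g : {linear F -> A}, forall k, g (i k) = f k.
Proof.
move=> xs sip; have [Q [u [v [p' [svp uv _ _]]]]] := pushout_ses f sip.
have [s sK] := xs _ _ _ svp; have [r [rv _]] := ses_retraction svp sK.
by exists (r \o u) => k /=; rewrite uv rv.
Qed.

(** For projective F, Ext^1(C, A) is the cokernel of Hom(F, A) -> Hom(K, A). Concretely, a lift of
    [p] to E restricts to a map K -> A; subtracting an extension of that map to F leaves a map that
    kills K and descends to a section. *)
Lemma ext_split_criterion K F C A (i : {linear K -> F}) (p : {linear F -> C}) :
  lifting F -> ses i p ->
  (forall f : {linear K -> A}, exists g : {linear F -> A}, forall k, g (i k) = f k) ->
  ext_split C A.
Proof.
move=> lF [inji sp exp] ext E j q [injj sq exq].
have [h hE] := lF _ _ q p sq.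
have [k|f fE] := @factor_inj _ _ _ j (h \o i) injj.
  by apply/exq; rewrite /= hE; apply/exp; exists k.
have [g gE] := ext f.
have [|s sE] := @factor_surj _ _ _ p (h \- (j \o g)) sp.
  by move=> x /exp [k <-] /=; rewrite gE fE /= subrr.
exists s => c; have [x <-] := sp c.
rewrite sE /= linearB hE; have -> : q (j (g x)) = 0 by apply/exq; exists (g x).
by rewrite subr0.
Qed.

Lemma sum_linear A B I (s : seq I) (F : I -> {linear A -> B}) :
  exists f : {linear A -> B}, forall x, f x = \sum_(u <- s) F u x.
Proof.
apply: linear_of => a x y; rewrite scaler_sumr -big_split /=.
by apply: eq_bigr => u _; rewrite linearP.
Qed.

Definition lin_comp A B C (g : {linear B -> C}) (f : {linear A -> B}) :
  {linear A -> C} := g \o f.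

(** * Modules generated by W and the class add W *)

Definition trace W X (x : X) :=
  exists s : seq ({linear W -> X} * W)%type, x = \sum_(u <- s) u.1 u.2.

(** Membership in Gen(W) without mention of direct sums; [quot_copowersP] proves the agreement. *)
Definition in_gen W X := forall x : X, trace W x.

(* The identity of M factors through a finite power of W. *)
Definition in_add W M := exists s : seq ({linear M -> W} * {linear W -> M})%type,
  forall x, x = \sum_(u <- s) u.2 (u.1 x).

Lemma in_add_refl W : in_add W W.
Proof.
exists [:: (idfun : {linear W -> W}, idfun : {linear W -> W})] => x.
by rewrite big_seq1.
Qed.

Lemma in_gen_refl W : in_gen W W.
Proof. by move=> x; exists [:: (idfun : {linear W -> W}, x)]; rewrite big_seq1. Qed.

Lemma in_add_retract W M N (i : {linear N -> M}) (p : {linear M -> N}) :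
  (forall x, p (i x) = x) -> in_add W M -> in_add W N.
Proof.
move=> pK [s sE]; exists [seq (lin_comp u.1 i, lin_comp p u.2) | u <- s] => x.
by rewrite big_map -[LHS]pK [in LHS](sE (i x)) linear_sum.
Qed.

Lemma in_add_prod W M N : in_add W M -> in_add W N -> in_add W (M * N)%type.
Proof.
move=> [s sE] [t tE].
have [inl inlE] := @prod_map M N M idfun \0.
have [inr inrE] := @prod_map M N N \0 idfun.
exists ([seq (lin_comp u.1 (fst : {linear (M * N)%type -> M}),
              lin_comp inl u.2) | u <- s] ++
        [seq (lin_comp u.1 (snd : {linear (M * N)%type -> N}),
              lin_comp inr u.2) | u <- t]) => -[x y].
by rewrite big_cat !big_map /= -!linear_sum -sE -tE inlE inrE /= pair_split.
Qed.

Lemma submod_trace W X : submod (@trace W X).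
Proof.
split=> [|a _ _ [s ->] [t ->]]; first by exists [::]; rewrite big_nil.
exists ([seq (u.1, a *: u.2) | u <- s] ++ t); rewrite big_cat big_map.
by rewrite scaler_sumr; congr (_ + _); apply: eq_bigr => u _; rewrite linearZ.
Qed.

(** Covering X one element at a time replaces a single surjection from a possibly infinite direct
    sum. *)
Lemma in_gen_cover W X :
  (forall x, exists Y (g : {linear Y -> X}) y, in_gen W Y /\ g y = x) ->
  in_gen W X.
Proof.
move=> cov x; have [Y [g [y [gY <-]]]] := cov x; have [s ->] := gY y.
exists [seq (lin_comp g u.1, u.2) | u <- s].
by rewrite big_map linear_sum.
Qed.

Lemma in_gen_surj W X Y (p : {linear Y -> X}) : surj p -> in_gen W Y -> in_gen W X.
Proof.
by move=> sp gY; apply: in_gen_cover => x; have [y <-] := sp x; exists Y, p, y.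
Qed.

Lemma in_add_gen W M : in_add W M -> in_gen W M.
Proof.
move=> [s sE] x; exists [seq (u.2, u.1 x) | u : {linear M -> W} * {linear W -> M} <- s].
by rewrite big_map /= -sE.
Qed.

(** Each map W -> M in a decomposition of the identity of M lifts to the extension; recombining the
    lifts with the coordinates M -> W gives a section. *)
Lemma ext_split_add W M X : in_add W M -> ext_split W X -> ext_split M X.
Proof.
move=> [s sE] xs E i p sip.
have /choice[l lE] (b : {linear W -> M}) :
    exists g : {linear W -> E}, forall c, p (g c) = b c.
  exact: ext_split_lift sip.
have [f fE] := sum_linear s (fun u => l u.2 \o u.1).
exists f => c; rewrite fE linear_sum [RHS]sE.
by apply: eq_bigr => u _ /=; rewrite lE.
Qed.


(** * Finitely presented modules *)

Local Notation fp M := (@finitely_presented R M).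
Local Notation fg M := (@finitely_generated R M).
Local Notation regular := ((R^c)^o : lmodType S).

Lemma fp_fg M : fp M -> fg M.
Proof. by move=> [m [n [f [g [sg _]]]]]; exists n, g. Qed.

Lemma free_map n M (y : 'I_n -> M) :
  exists f : {linear 'rV[S]_n -> M}, forall i, f (delta_mx 0 i) = y i.
Proof.
have [|f fE] := @linear_of 'rV[S]_n M (fun v => \sum_i v 0 i *: y i).
  move=> a v w; rewrite scaler_sumr -big_split /=; apply: eq_bigr => i _.
  by rewrite !mxE scalerDl scalerA.
exists f => i; rewrite fE (bigD1 i) //= big1 ?addr0.
  by rewrite mxE !eqxx scale1r.
by move=> j /negPf ji; rewrite mxE eqxx ji scale0r.
Qed.

Lemma free_ext n M (f g : {linear 'rV[S]_n -> M}) :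
  (forall i, f (delta_mx 0 i) = g (delta_mx 0 i)) -> forall v, f v = g v.
Proof.
move=> fg v; rewrite (row_sum_delta v) !linear_sum.
by apply: eq_bigr => i _; rewrite !linearZ fg.
Qed.

Lemma free_lifting n : lifting 'rV[S]_n.
Proof.
move=> A B e f se; have [s sK] := choice se.
have [g gE] := free_map (fun i => s (f (delta_mx 0 i))).
exists g; apply: (@free_ext _ _ (e \o g)) => i.
by rewrite /= gE sK.
Qed.

Lemma rV_prod n m : exists (u : {linear 'rV[S]_(n + m) -> ('rV[S]_n * 'rV[S]_m)%type})
    (v : {linear ('rV[S]_n * 'rV[S]_m)%type -> 'rV[S]_(n + m)}),
  cancel u v /\ cancel v u.
Proof.
have [u uE] := prod_map (@lsubmx S 1 n m) (@rsubmx S 1 n m).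
have [|v vE] := @linear_of ('rV[S]_n * 'rV[S]_m)%type 'rV[S]_(n + m)
    (fun x => row_mx x.1 x.2).
  by move=> a [x y] [x' y'] /=; rewrite scale_row_mx add_row_mx.
exists u, v; split=> [x|[x y]]; rewrite uE vE /=; first exact: hsubmxK.
by rewrite row_mxKl row_mxKr.
Qed.

Lemma fg_prod M N : fg M -> fg N -> fg (M * N)%type.
Proof.
move=> [m [f sf]] [n [g sg]]; have [u [v [uK vK]]] := rV_prod m n.
have [h hE] := prod_map (lin_comp f fst) (lin_comp g snd).
exists (m + n)%N, (h \o u) => -[x y].
have [[a <-] [b <-]] := (sf x, sg y).
by exists (v (a, b)); rewrite /= vK hE.
Qed.

(** Allows presentations with any copy F of a free module as generators and any finitely generated K
    as relations. *)
Lemma fp_intro n F K M (u : {linear 'rV[S]_n -> F}) (v : {linear F -> 'rV[S]_n})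
    (f : {linear K -> F}) (g : {linear F -> M}) :
  cancel u v -> cancel v u -> fg K -> surj g ->
  (forall x, g x = 0 <-> exists k, f k = x) -> fp M.
Proof.
move=> uK vK [m [h sh]] sg ex.
exists m, n, (v \o f \o h), (g \o u); split=> [y|x].
  by have [x <-] := sg y; exists (v x); rewrite /= vK.
split=> [/ex [k kE]|[w <-] /=].
  have [w wE] := sh k; exists w.
  by rewrite /= wE kE uK.
by rewrite vK; apply/ex; exists (h w).
Qed.

Lemma fg_rV n : fg 'rV[S]_n.
Proof. by exists n, idfun => y; exists y. Qed.

Lemma fp_rV n : fp 'rV[S]_n.
Proof.
apply: (@fp_intro n 'rV[S]_n 'rV[S]_n _ idfun idfun \0 idfun) => //.
- exact: fg_rV.
- by move=> y; exists y.
- by move=> x; split=> [/= ->|[_ <-] //]; exists 0.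
Qed.

(** Horseshoe construction: the generators are those of A and lifts of those of C. A relation of C,
    evaluated on the lifts, lands in A, and [k] expresses the resulting element by the generators of
    A. *)
Lemma fp_ext A E C (i : {linear A -> E}) (p : {linear E -> C}) :
  ses i p -> fp A -> fp C -> fp E.
Proof.
move=> [inji sp ex] [m [n [f [g [sg exg]]]]] [m' [n' [f' [g' [sg' exg']]]]].
have [l lE] := free_lifting g' sp.
have [k kE] : exists k : {linear 'rV[S]_m' -> 'rV[S]_n},
    forall z, i (g (k z)) = l (f' z).
  have [z|k0 k0E] := @factor_inj _ _ _ i (l \o f') inji.
    by apply/ex; rewrite /= lE; apply/exg'; exists z.
  have [k kE] := free_lifting k0 sg.
  by exists k => z; rewrite kE k0E.
have [u [v [uK vK]]] := rV_prod n n'.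
have [G GE] : exists G : {linear ('rV[S]_n * 'rV[S]_n')%type -> E},
    forall x, G x = i (g x.1) + l x.2.
  by exists (lin_comp (lin_comp i g) fst \+ lin_comp l snd).
have [H HE] := prod_map (lin_comp f fst \- lin_comp k snd)
  (lin_comp f' snd : {linear ('rV[S]_m * 'rV[S]_m')%type -> _}).
apply: (@fp_intro _ _ _ _ u v H G) => //.
- exact: fg_prod (fg_rV _) (fg_rV _).
- move=> e; have [z zE] := sg' (p e).
  have /ex [a aE] : p (e - l z) = 0 by rewrite linearB lE zE subrr.
  have [y yE] := sg a; exists (y, z).
  by rewrite GE /= yE aE subrK.
- move=> [x y]; rewrite GE /=; split=> [e0|].
    have /exg' [z zE] : g' y = 0.
      rewrite -lE; have := congr1 p e0; rewrite linearD linear0.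
      have -> : p (i (g x)) = 0 by apply/ex; exists (g x).
      by rewrite add0r.
    have /exg [w wE] : g (x + k z) = 0.
      by apply: inji; rewrite linearD linearD kE zE e0 linear0.
    by exists (w, z); rewrite HE /= /lin_comp /= wE zE addrK.
  case=> -[w z]; rewrite HE /= /lin_comp /= => -[<- <-].
  rewrite -kE -linearD -linearD subrK.
  have -> : g (f w) = 0 by apply/exg; exists w.
  by rewrite linear0.
Qed.

(** The relations of C are those of Y together with lifts of the images of the generators of X. *)
Lemma fp_cokernel X Y C (f : {linear X -> Y}) (q : {linear Y -> C}) :
  fg X -> fp Y -> surj q -> (forall y, q y = 0 <-> exists x, f x = y) -> fp C.
Proof.
move=> [k [r sr]] [m [n [f0 [g [sg exg]]]]] sq ex.
have [h hE] := free_lifting (f \o r) sg.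
apply: (@fp_intro n 'rV[S]_n ('rV[S]_m * 'rV[S]_k)%type _ idfun idfun
  (lin_comp f0 fst \+ lin_comp h snd) (q \o g)) => //.
- exact: fg_prod (fg_rV _) (fg_rV _).
- by move=> c; have [y <-] := sq c; have [x <-] := sg y; exists x.
- move=> x /=; split=> [/ex [a aE]|[[w z] <-] /=].
    have [z zE] := sr a.
    have /exg [w wE] : g (x - h z) = 0 by rewrite linearB hE /= zE aE subrr.
    by exists (w, z); rewrite /= /lin_comp /= wE subrK.
  rewrite /lin_comp /= linearD hE /=.
  have -> : g (f0 w) = 0 by apply/exg; exists w.
  by rewrite add0r; apply/ex; exists (r z).
Qed.

(** A retract is the cokernel of the complementary idempotent. *)
Lemma fp_retract A M (i : {linear A -> M}) (p : {linear M -> A}) :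
  (forall x, p (i x) = x) -> fp M -> fp A.
Proof.
move=> pK fM; apply: (@fp_cokernel M M A (idfun \- (i \o p)) p) => //.
- exact: fp_fg.
- by move=> a; exists (i a).
- move=> y; split=> [py|[x <-]]; last by rewrite /= linearB pK subrr.
  by exists y; rewrite /= py linear0 subr0.
Qed.

Lemma fp_prod M N : fp M -> fp N -> fp (M * N)%type.
Proof.
move=> fM fN; have [inl inlE] := @prod_map M N M idfun \0.
apply: (@fp_ext M (M * N)%type N inl snd) => //; split.
- by move=> x y; rewrite !inlE => -[].
- by move=> y; exists (0, y).
- move=> [x y] /=; split=> [->|[a]]; first by exists x; rewrite inlE.
  by rewrite inlE => -[].
Qed.

(** Induction on the decomposition of the identity builds a finite power of W. The predicate [Pr]
    carries along whatever is known of W and stable under binary products. *)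
Lemma in_add_retract_of W M (Pr : lmodType S -> Prop) :
  Pr W -> (forall A B, Pr A -> Pr B -> Pr (A * B)%type) -> in_add W M ->
  exists D (f : {linear M -> D}) (g : {linear D -> M}),
    Pr D /\ forall x, g (f x) = x.
Proof.
move=> PrW Prprod [s sE].
suff [D [f [g [PrD gf]]]] : exists D (f : {linear M -> D}) (g : {linear D -> M}),
    Pr D /\ forall x, g (f x) = \sum_(u <- s) u.2 (u.1 x).
  by exists D, f, g; split=> // x; rewrite gf -sE.
elim: s {sE} => [|u s [D [f [g [PrD gf]]]]].
  (* The empty sum factors through W itself, since [Pr] is not known for the zero module. *)
  by exists W, \0, \0; split=> // x; rewrite big_nil.
have [h hE] := prod_map u.1 f.
exists (W * D)%type, h, (lin_comp u.2 fst \+ lin_comp g snd).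
by split=> [|x]; [exact: Prprod|rewrite big_cons /= /lin_comp /= hE /= gf].
Qed.

Lemma fp_in_add W M : fp W -> in_add W M -> fp M.
Proof.
move=> fW aM; have [D [f [g [fD gfK]]]] := in_add_retract_of fW fp_prod aM.
exact: fp_retract gfK fD.
Qed.

Lemma regular_rV : exists (u : {linear regular -> 'rV[S]_1})
  (v : {linear 'rV[S]_1 -> regular}), cancel u v /\ cancel v u.
Proof.
have [|u uE] := @linear_of regular 'rV[S]_1 (fun a => const_mx a).
  by move=> a x y; apply/matrixP => i j; rewrite !mxE.
have [|v vE] := @linear_of 'rV[S]_1 regular (fun x => x 0 0).
  by move=> a x y; rewrite !mxE.
exists u, v; split=> x; rewrite uE vE ?mxE //.
by apply/matrixP => i j; rewrite mxE !ord1.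
Qed.

Lemma fp_regular : fp regular.
Proof. by have [u [v [uK _]]] := regular_rV; apply: fp_retract uK (fp_rV 1). Qed.

Lemma regular_lifting : lifting regular.
Proof.
have [u [v [uK _]]] := regular_rV.
move=> A B e f se; have [g gE] := free_lifting (f \o v) se.
by exists (g \o u) => x /=; rewrite gE /= uK.
Qed.

Lemma regular_map M (x : M) : exists f : {linear regular -> M}, f 1 = x.
Proof.
have [|f fE] := @linear_of regular M (fun a => (a : S) *: x).
  by move=> a b c; rewrite scalerDl scalerA.
by exists f; rewrite fE scale1r.
Qed.

Lemma regular_ext M (f g : {linear regular -> M}) : f 1 = g 1 -> f = g.
Proof.
move=> fg; apply: linear_ext; apply/funext => a.
have -> : a = (a : S) *: (1 : regular) by rewrite [RHS]mulr1.
by rewrite !linearZ fg.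
Qed.

Lemma in_gen_regular M : in_gen regular M.
Proof.
move=> x; have [f <-] := regular_map x.
by exists [:: (f, 1)]; rewrite big_seq1.
Qed.

(** Each element of X is in the image of a finite power of W, and finitely many elements share one
    such power. Covering only the image of the finitely generated P serves two uses: P = X gives a
    surjection, and general P allows lifting a map out of P. *)
Lemma in_gen_collect W X P (Pr : lmodType S -> Prop) (f : {linear P -> X}) :
  Pr W -> (forall A B, Pr A -> Pr B -> Pr (A * B)%type) -> fg P -> in_gen W X ->
  exists D (q : {linear D -> X}), Pr D /\ forall z, exists d, q d = f z.
Proof.
move=> PrW Prprod [n [h sh]] gX.
have one (y : X) : exists D (q : {linear D -> X}), Pr D /\ exists d, q d = y.
  have [s ->] := gX y; elim: s => [|u s [D [q [PrD [d dE]]]]].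
    by exists W, \0; split=> //; exists 0; rewrite big_nil.
  exists (W * D)%type, (lin_comp u.1 fst \+ lin_comp q snd).
  split; first exact: Prprod.
  by exists (u.2, d); rewrite big_cons /= /lin_comp /= dE.
have all (ys : seq X) : exists D (q : {linear D -> X}),
    Pr D /\ forall y, y \in ys -> exists d, q d = y.
  elim: ys => [|y ys [D [q [PrD qE]]]]; first by exists W, \0.
  have [D' [q' [PrD' [d' d'E]]]] := one y.
  exists (D' * D)%type, (lin_comp q' fst \+ lin_comp q snd).
  split=> [|z]; first exact: Prprod.
  rewrite inE => /predU1P[->|/qE [d <-]].
    by exists (d', 0); rewrite /= /lin_comp /= d'E linear0 addr0.
  by exists (0, d); rewrite /= /lin_comp /= linear0 add0r.
have [D [q [PrD qE]]] := all [seq f (h (delta_mx 0 i)) | i : 'I_n].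
have /choice[d dE] (i : 'I_n) : exists d, q d = f (h (delta_mx 0 i)).
  by apply: qE; apply: image_f.
exists D, q; split=> // z; have [v <-] := sh z.
exists (\sum_i v 0 i *: d i); rewrite [v in RHS]row_sum_delta !linear_sum.
by apply: eq_bigr => i _; rewrite !linearZ /= dE.
Qed.


(** * Vanishing of Ext^1 under retracts, products, extensions and quotients *)

Lemma section_of_retraction A E C (i : {linear A -> E}) (p : {linear E -> C})
    (r : {linear E -> A}) : ses i p -> (forall a, r (i a) = a) ->
  exists s : {linear C -> E}, forall c, p (s c) = c.
Proof.
move=> [inji sp ex] rK.
have [|s sE] := @factor_surj _ _ _ p (idfun \- (i \o r)) sp.
  by move=> x /ex [a <-]; rewrite /= rK subrr.
exists s => c; have [x <-] := sp c; rewrite sE /= linearB.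
have -> : p (i (r x)) = 0 by apply/ex; exists (r x).
by rewrite subr0.
Qed.

Lemma ext_split_retract C D X (i : {linear D -> C}) (p : {linear C -> D}) :
  (forall x, p (i x) = x) -> ext_split C X -> ext_split D X.
Proof.
move=> pK xC E j q sjq; have [g gE] := ext_split_lift p xC sjq.
by exists (g \o i) => x /=; rewrite gE pK.
Qed.

Lemma ext_split_prod C A B :
  ext_split C A -> ext_split C B -> ext_split C (A * B)%type.
Proof.
move=> xA xB E i p sip.
have [f fE] := ext_split_extend (fst : {linear (A * B)%type -> A}) xA sip.
have [g gE] := ext_split_extend (snd : {linear (A * B)%type -> B}) xB sip.
have [r rE] := prod_map f g.
by apply: (section_of_retraction (r := r) sip) => -[a b]; rewrite rE fE gE.
Qed.

Lemma lifting_retract P F (i : {linear P -> F}) (p : {linear F -> P}) :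
  (forall x, p (i x) = x) -> lifting F -> lifting P.
Proof.
move=> pK lF A B e f se; have [g gE] := lF _ _ e (f \o p) se.
by exists (g \o i) => x /=; rewrite gE /= pK.
Qed.

(** By hand, the exactness of Ext^1(C, X) -> Ext^1(P, X) -> Ext^1(A, X) = 0: lift A into the
    extension E of P by X; the quotient of E by this copy of A is an extension of C by X, which
    splits. *)
Lemma ext_split_middle A P C X (i : {linear A -> P}) (q : {linear P -> C}) :
  ses i q -> lifting A -> ext_split C X -> ext_split P X.
Proof.
move=> [inji sq exq] lA xC E j e [injj se exe].
have [g gE] := lA _ _ e i se.
have injg : injective g by move=> a b ab; apply: inji; rewrite -!gE ab.
have [Q [c [_ sc exc]]] := ses_cokernel injg.
have [|e' e'E] := @factor_surj _ _ _ c (q \o e) sc.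
  by move=> x /exc [a <-] /=; rewrite gE; apply/exq; exists a.
have scj : ses (c \o j) e'.
  split.
  - apply: linear_inj => x /= /exc [a aE].
    have ia0 : i a = i 0 by rewrite -gE aE linear0; apply/exe; exists x.
    by apply: injj; rewrite -aE (inji _ _ ia0) !linear0.
  - move=> z; have [y <-] := sq z; have [x <-] := se y.
    by exists (c x); rewrite e'E.
  - move=> z; have [y <-] := sc z; rewrite e'E /=; split=> [/exq [a aE]|].
      have /exe [x xE] : e (y - g a) = 0 by rewrite linearB gE aE subrr.
      exists x; rewrite xE linearB.
      have -> : c (g a) = 0 by apply/exc; exists a.
      by rewrite subr0.
    case=> x xE; have := e'E (j x); rewrite xE e'E /= => ->.
    have -> : e (j x) = 0 by apply/exe; exists x.
    by rewrite linear0.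
have [s sK] := xC _ _ _ scj; have [_ _ exz] := scj.
(* E is the pullback of P -> C <- Q, so the section [s] of Q -> C induces one of E -> P. *)
have [ec ecE] := prod_map e c.
have [f fE] := prod_map (idfun : {linear P -> P}) (s \o q).
have [||h hE] := @factor_inj _ _ _ ec f.
- apply: linear_inj => x; rewrite ecE => -[ex0 /exc [a aE]].
  have ia0 : i a = i 0 by rewrite -gE aE linear0.
  by rewrite -aE (inji _ _ ia0) linear0.
- move=> x; have [y yE] := se x.
  have /exz [a aE] : e' (c y - s (q x)) = 0.
    by rewrite linearB e'E /= yE sK subrr.
  exists (y - j a); rewrite ecE fE /= !linearB yE.
  have -> : e (j a) = 0 by apply/exe; exists a.
  by rewrite subr0 -[c (j a)]/((c \o j) a) aE opprB addrC subrK.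
exists h => x; have := hE x; rewrite ecE fE => -[].
by [].
Qed.

(** Ext^1(W, X) obstructs the extension of maps P1 -> X along P1 -> P0. As P1 is finitely generated
    and projective, such a map lifts to a finite power of W over X, where it extends. *)
Lemma in_gen_ext_split P1 P0 W X (i : {linear P1 -> P0}) (p : {linear P0 -> W}) :
  lifting P1 -> fg P1 -> lifting P0 -> ses i p -> ext_split W W -> in_gen W X ->
  ext_split W X.
Proof.
move=> l1 fg1 l0 sip xW gX; apply: (ext_split_criterion l0 sip) => f.
(* [Pr D] expresses Ext^1(W, D) = 0; it passes to products, hence to finite powers of W. *)
pose Pr D := forall f : {linear P1 -> D},
  exists g : {linear P0 -> D}, forall k, g (i k) = f k.
have [||D [q [PrD qE]]] := @in_gen_collect W X P1 Pr f _ _ fg1 gX.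
- by move=> h; apply: ext_split_extend sip.
- move=> A B PrA PrB h; have [a aE] := PrA (lin_comp fst h).
  have [b bE] := PrB (lin_comp snd h); have [g gE] := prod_map a b.
  by exists g => k; rewrite gE aE bE /lin_comp /=; case: (h k).
(* The pullback T of [f] and [q] maps onto P1, as the image of [f] lies in that of [q]; a section
   over the projective P1 gives the lift of [f] to D. *)
have [|T [t [injt tE]]] := @submod_inj (P1 * D)%type (fun x => f x.1 = q x.2).
  split=> [|a x y /= fx fy]; first by rewrite !linear0.
  by rewrite !linearP fx fy.
have [|h hE] := l1 _ _ (fst \o t) idfun.
  by move=> z; have [d dE] := qE z; have [x xE] := (tE (z, d)).1 (esym dE);
    exists x; rewrite /= xE.
have [g gE] := PrD (snd \o t \o h); exists (q \o g) => k /=.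
rewrite gE /=; have /tE <- : exists x, t x = t (h k) by exists (h k).
by rewrite [in LHS](hE k : (t (h k)).1 = k).
Qed.

(** * Tilting modules *)

Section Coherent.
(** Right coherence in elementwise form, supplied by [coherent_kernel]. *)
Hypothesis coh : forall X Y (f : {linear X -> Y}), fp X -> fp Y ->
  exists K (k : {linear K -> X}),
    [/\ fp K, injective k & forall x, f x = 0 <-> exists a, k a = x].

(** * Embeddings and presentations by a tilting module *)

Section TiltingModule.
Variables (W W0 W1 : lmodType S).
Variables (j : {linear regular -> W0}) (q : {linear W0 -> W1}).
Hypotheses (fW : fp W) (gen_ext : forall X, in_gen W X -> ext_split W X)
  (W0P : in_add W W0) (W1P : in_add W W1) (sjq : ses j q).

(** An element of X is a map R -> X, which extends to W0 because Ext^1(W1, X) = 0; so it lies in the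
    image of W0. *)
Lemma ext_split_in_gen X : ext_split W X -> in_gen W X.
Proof.
move=> xW; apply: in_gen_cover => x; have [f <-] := regular_map x.
have [g gE] := ext_split_extend f (ext_split_add W1P xW) sjq.
by exists W0, g, (j 1); split; [exact: in_add_gen|rewrite gE].
Qed.

(** Push out a coresolution of a finite power of R along a surjection onto M: the new middle term is
    a quotient of an object of add W, and the cokernel is unchanged. *)
Lemma in_gen_embed M : fp M -> exists L B (v : {linear M -> L}) (p : {linear L -> B}),
  [/\ ses v p, in_add W B, in_gen W L & fp L].
Proof.
move=> fM; pose Pr F := exists A B (i : {linear F -> A}) (p : {linear A -> B}),
  [/\ ses i p, in_add W A & in_add W B].
have [||F [r [[A [B [i [p [sip addA addB]]]]] rE]]] :=
  @in_gen_collect regular M M Pr idfun _ _ (fp_fg fM) (@in_gen_regular M).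
- by exists W0, W1, j, q.
- move=> F F' [A [B [i [p [sip aA aB]]]]] [A' [B' [i' [p' [sip' aA' aB']]]]].
  have [i2 [p2 s2]] := ses_prod sip sip'.
  exists (A * A')%type, (B * B')%type, i2, p2.
  by split=> //; apply: in_add_prod.
have [Q [u [v [p' [svp uv quv _]]]]] := pushout_ses r sip.
exists Q, B, v, p'; split=> //; last exact: fp_ext svp fM (fp_in_add fW addB).
apply: (in_gen_surj (p := u)) (in_add_gen addA).
move=> z; have [x [a ->]] := quv z; have [f fE] := rE a.
by exists (x + i f); rewrite linearD uv fE.
Qed.

Lemma in_gen_presentation X : fp X -> in_gen W X ->
  exists Q K (i : {linear K -> Q}) (p : {linear Q -> X}),
    [/\ ses i p, in_add W Q, in_gen W K & fp K].
Proof.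
move=> fX gX; have [|D [d [addD dE]]] := @in_gen_collect W X X (in_add W) idfun
  (in_add_refl W) _ (fp_fg fX) gX.
  by move=> A B; exact: in_add_prod.
have fD := fp_in_add fW addD.
have [K [k [fK injk kE]]] := coh d fD fX.
have skd : ses k d by split.
have [L [B [v [b [svb addB gL fL]]]]] := in_gen_embed fK.
have [Q [u [v' [p' [svp uv _ push]]]]] := pushout_ses v skd.
have [q' suq] := push _ _ svb.
(* The sequence 0 -> D -> Q -> B -> 0 splits because B is in add W and D in Gen(W), so Q is a
   retract of D x B. *)
have [s sK] := ext_split_add addB (gen_ext (in_add_gen addD)) suq.
have [r [rK rE]] := ses_retraction suq sK.
exists Q, L, v', p'; split=> //.
have [f fE] := prod_map r q'.
apply: (in_add_retract (i := f) (p := lin_comp u fst \+ lin_comp s snd)).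
  by move=> x; rewrite /= /lin_comp /= fE /= rE subrK.
exact: in_add_prod.
Qed.

End TiltingModule.

(** * Coresolution of R and projective dimension of a tilting object *)

Section TiltingObject.
(* G and Ad stand for Gen V and Add V in mod-R. *)
Variables (G Ad : lmodType S -> Prop).
Hypotheses (Ad_fp : forall Y, Ad Y -> fp Y) (Ad_G : forall Y, Ad Y -> G Y)
  (Ad_retract : forall Y Z (i : {linear Z -> Y}) (p : {linear Y -> Z}),
    (forall z, p (i z) = z) -> Ad Y -> Ad Z)
  (G_fp : forall X, G X -> fp X)
  (G_surj : forall X Y (p : {linear X -> Y}), surj p -> fp Y -> G X -> G Y)
  (G_prod : forall X Y, G X -> G Y -> G (X * Y)%type)
  (G_pres : forall X, G X -> exists Y K (i : {linear K -> Y}) (p : {linear Y -> X}),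
    [/\ ses i p, Ad Y & G K])
  (Ad_ext : forall Y X, Ad Y -> G X -> ext_split Y X)
  (G_embed : forall M, fp M -> exists T (t : {linear M -> T}), G T /\ injective t).

Lemma regular_coresolution : exists Y0 Y1 (i : {linear regular -> Y0})
  (p : {linear Y0 -> Y1}), [/\ ses i p, Ad Y0 & Ad Y1].
Proof.
have [T [t [GT injt]]] := G_embed fp_regular.
have [Y [_ [_ [y [[_ sy _] AY _]]]]] := G_pres GT.
(* Projectivity of R moves the embedding into T to an embedding into Y, an object of [Ad]. *)
have [l lE] := regular_lifting t sy.
have injl : injective l by move=> a b ab; apply: injt; rewrite -!lE ab.
have [C [c slc]] := ses_cokernel injl; have [_ sc exc] := slc.
have fC : fp C := fp_cokernel (fp_fg fp_regular) (Ad_fp AY) sc exc.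
have GC : G C := G_surj sc fC (Ad_G AY).
have [Y0 [K [k [d [skd AY0 GK]]]]] := G_pres GC.
have [P [a [b [k' [skb _ pull]]]]] := pullback_ses c skd.
have [j' sja] := pull _ _ slc.
(* The sequence 0 -> K -> P -> Y -> 0 splits, which makes P a quotient of K x Y and puts it in
   [G]. *)
have [s sK] := Ad_ext AY GK skb.
have [r [rK rE]] := ses_retraction skb sK.
have GP : G P.
  apply: (@G_surj (K * Y)%type P (lin_comp k' fst \+ lin_comp s snd)).
  - by move=> x; exists (r x, b x); rewrite /= /lin_comp /= rE subrK.
  - exact: fp_ext skb (G_fp GK) (Ad_fp AY).
  - exact/G_prod/Ad_G.
(* The sequence 0 -> R -> P -> Y0 -> 0 gives Ext^1(P, K') = 0, so a presentation of P by Y' splits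
   and P is a retract of Y'. *)
have [Y' [K' [k'' [d' [skd' AY' GK']]]]] := G_pres GP.
have [s' s'K] := ext_split_middle sja regular_lifting (Ad_ext AY0 GK') skd'.
by exists P, Y0, j', a; split=> //; apply: Ad_retract s'K AY'.
Qed.

(** The syzygy K is projective once a free cover of it splits, and the splitting comes from the
    vanishing of Ext^1(W, -) on quotients of objects of [G]. *)
Lemma projective_resolution W : fp W -> (forall X, G X -> ext_split W X) ->
  exists n K (i : {linear K -> 'rV[S]_n}) (p : {linear 'rV[S]_n -> W}),
    [/\ ses i p, fg K & lifting K].
Proof.
move=> fW xW; have [n [p sp]] := fp_fg fW.
have [K [k [fK injk kE]]] := coh p (fp_rV n) fW.
exists n, K, k, p; split=> //; first exact: fp_fg.
(* To split p' : R^m -> K, embed R^m in T in G: the map K -> T / ker p' extends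
   to R^n because Ext^1(W, T / ker p') = 0, and then lifts to T. *)
have [m [p' sp']] := fp_fg fK.
have [K' [k' [fK' injk' k'E]]] := coh p' (fp_rV m) fK.
have [T [t [GT injt]]] := G_embed (fp_rV m).
have [|C [c [_ sc exc]]] := @ses_cokernel K' T (t \o k').
  by move=> x y /injt /injk'.
have fC : fp C := fp_cokernel (fp_fg fK') (G_fp GT) sc exc.
have [|phi phiE] := @factor_surj _ _ _ p' (c \o t) sp'.
  by move=> x /k'E [a <-]; apply/exc; exists a.
have injphi : injective phi.
  apply: linear_inj => y; have [x <-] := sp' y; rewrite phiE => /exc [a /injt <-].
  by apply/k'E; exists a.
have [||Phi PhiE] := @ext_split_extend K _ W C k p phi; first exact/xW/(G_surj sc).
  by split.
have [Psi PsiE] := free_lifting Phi sc.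
(* [Psi] takes K into the image of R^m: modulo the image of ker p', its value at [y] is that of any
   preimage of [y] under [p']. *)
have [y|psi psiE] := @factor_inj _ _ _ t (Psi \o k) injt.
  have [x xE] := sp' y.
  have /exc [a aE] : c (Psi (k y) - t x) = 0.
    by rewrite linearB PsiE PhiE -xE phiE subrr.
  by exists (k' a + x); rewrite linearD /= -[t (k' a)]/((t \o k') a) aE subrK.
apply: (lifting_retract (i := psi) (p := p')); last exact: free_lifting.
move=> y; apply: injphi; rewrite phiE /= psiE /= PsiE PhiE //.
Qed.

End TiltingObject.
End Coherent.
End Modules.

(** * Full subcategories of Mod-R *)

(* Cat is identified with a full subcategory of Mod-R through U, phi and psi;
   below, e is a basis of U r, so that maps r -> x are the elements of U x.  This
   is used for both Mod-R and mod-R. *)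
Section ConcreteCategory.
Variables (R : pzRingType) (Cat : category) (U : Cat -> lmodType R^c).
Variables (phi : forall x y : Cat, Defs.hom x y -> {linear U x -> U y})
  (psi : forall x y : Cat, {linear U x -> U y} -> Defs.hom x y).
Arguments phi {x y}.
Arguments psi {x y}.
Hypotheses (psiK : forall (x y : Cat) (f : {linear U x -> U y}), phi (psi f) = f)
  (phiK : forall (x y : Cat) (f : Defs.hom x y), psi (phi f) = f)
  (phi_cmp : forall (x y z : Cat) (g : Defs.hom y z) (f : Defs.hom x y) a,
    phi (cmp g f) a = phi g (phi f a)).

Lemma phi_ext (x y : Cat) (f g : Defs.hom x y) : phi f =1 phi g -> f = g.
Proof.
by move=> fg; rewrite -(phiK f) -(phiK g); congr psi; apply/linear_ext/funext.
Qed.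

Lemma phi_id (x : Cat) a : phi (idm x) a = a.
Proof.
have {1}-> : a = phi (psi (idfun : {linear U x -> U x})) a by rewrite psiK.
by rewrite -phi_cmp cmp_idl psiK.
Qed.

Lemma zero_obj_of (z : Cat) : (forall a : U z, a = 0) -> zero_obj z.
Proof.
move=> z0 x; split; exists (psi \0); split=> // f _; apply: phi_ext => a.
  by rewrite (z0 a) !linear0.
by rewrite psiK; apply/esym/z0.
Qed.

Lemma zero_obj0 (z : Cat) : zero_obj z -> forall a : U z, a = 0.
Proof.
move=> zz a; have [_ [f [_ fE]]] := zz z.
by rewrite -(phi_id a) -(fE (idm z) I) (fE (psi \0) I) psiK.
Qed.

Hypothesis cokerP : forall (x y : Cat) (f : {linear U x -> U y}),
  exists (z : Cat) (p : {linear U y -> U z}),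
    surj p /\ forall b, p b = 0 <-> exists a, f a = b.
Variables (r : Cat) (e : U r).
Hypotheses
  (r_ex : forall (M : lmodType R^c) (a : M), exists f : {linear U r -> M}, f e = a)
  (r_uni : forall (M : lmodType R^c) (f g : {linear U r -> M}), f e = g e -> f = g).

Lemma zero_morP (x y : Cat) (f : Defs.hom x y) : zero_mor f <-> forall a, phi f a = 0.
Proof.
split=> [[z [g [h [/zero_obj0 z0 ->]]]] a|f0].
  by rewrite phi_cmp (z0 (phi h a)) linear0.
(* The cokernel of an identity supplies a zero object. *)
have [z [p [sp pE]]] := @cokerP r r idfun.
have z0 (a : U z) : a = 0.
  by have [b <-] := sp a; apply/pE; exists b.
exists z, (psi \0), (psi \0); split; first exact: zero_obj_of.
by apply: phi_ext => a; rewrite f0 phi_cmp !psiK.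
Qed.

(** A kernel element is a map from [r], to be compared with the zero map. *)
Lemma monoP (x y : Cat) (f : Defs.hom x y) : mono f <-> injective (phi f).
Proof.
split=> [mf|injf w g h gh].
  apply: linear_inj => a fa0; have [g gE] := r_ex a.
  have : psi g = psi \0.
    apply: mf; rewrite -[LHS]phiK -[RHS]phiK; congr psi; apply: r_uni.
    by rewrite !phi_cmp !psiK gE fa0 linear0.
  by move/(congr1 (fun k => phi k e)); rewrite !psiK gE.
by apply: phi_ext => a; apply: injf; rewrite -!phi_cmp gh.
Qed.

Lemma epiP (x y : Cat) (f : Defs.hom x y) : epi f <-> surj (phi f).
Proof.
split=> [ef b|sf w g h gh].
  have [z [p [sp pE]]] := cokerP (phi f).
  apply/pE; have : psi p = psi \0.
    apply: ef; apply: phi_ext => a; rewrite !phi_cmp !psiK /=.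
    by apply/pE; exists a.
  by move/(congr1 (fun k => phi k b)); rewrite !psiK.
by apply: phi_ext => b; have [a <-] := sf b; rewrite -!phi_cmp gh.
Qed.

Lemma kernelP (x y k : Cat) (f : Defs.hom x y) (i : Defs.hom k x) : is_kernel f i <->
  injective (phi i) /\ forall b, phi f b = 0 <-> exists a, phi i a = b.
Proof.
split=> [[/zero_morP fi0 univ]|[inji ex]]; split.
- apply/monoP => w g h gh.
  have [|l [_ lu]] := univ w (cmp i h).
    by apply/zero_morP => a; rewrite cmpA phi_cmp fi0.
  by rewrite -(lu g gh) -(lu h erefl).
- move=> b; split=> [fb0|[a <-]]; last by rewrite -phi_cmp fi0.
  have [g gE] := r_ex b; have [|l [lE _]] := univ r (psi g).
    have f0 : lin_comp (phi f) g = \0 by apply: r_uni; rewrite /lin_comp /= gE fb0.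
    apply/zero_morP => a; rewrite phi_cmp psiK.
    by rewrite -[LHS]/(lin_comp (phi f) g a) f0.
  by exists (phi l e); rewrite -phi_cmp lE psiK.
- by apply/zero_morP => a; rewrite phi_cmp; apply/ex; exists a.
move=> w g /zero_morP fg0; have [a|h hE] := @factor_inj _ _ _ _ (phi i) (phi g) inji.
  by apply/ex; rewrite -phi_cmp.
exists (psi h); split=> [|h' h'E]; apply: phi_ext => a.
  by rewrite phi_cmp psiK.
by apply: inji; rewrite psiK hE -phi_cmp h'E.
Qed.

Lemma cokernelP (x y c : Cat) (f : Defs.hom x y) (p : Defs.hom y c) : is_cokernel f p <->
  surj (phi p) /\ forall b, phi p b = 0 <-> exists a, phi f a = b.
Proof.
split=> [[/zero_morP pf0 univ]|[sp ex]]; split.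
- apply/epiP => w g h gh.
  have [|l [_ lu]] := univ w (cmp h p).
    by apply/zero_morP => a; rewrite -cmpA phi_cmp pf0 linear0.
  by rewrite -(lu g gh) -(lu h erefl).
- move=> b; split=> [pb0|[a <-]]; last by rewrite -phi_cmp pf0.
  have [z [q [sq qE]]] := cokerP (phi f).
  have [|l [lE _]] := univ z (psi q).
    by apply/zero_morP => a; rewrite phi_cmp psiK; apply/qE; exists a.
  by apply/qE; rewrite -[q]psiK -lE phi_cmp pb0 linear0.
- by apply/zero_morP => a; rewrite phi_cmp; apply/ex; exists a.
move=> w g /zero_morP gf0.
have [|h hE] := @factor_surj _ _ _ _ (phi p) (phi g) sp.
  by move=> b /ex [a <-]; rewrite -phi_cmp.
exists (psi h); split=> [|h' h'E]; apply: phi_ext => b.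
  by rewrite phi_cmp psiK.
by have [a <-] := sp b; rewrite psiK hE -phi_cmp h'E.
Qed.

Lemma short_exactP (x y z : Cat) (i : Defs.hom x y) (p : Defs.hom y z) :
  short_exact i p <-> ses (phi i) (phi p).
Proof.
split=> [[/kernelP [inji ex] /cokernelP [sp _]]|[inji sp ex]]; first by split.
by split; [apply/kernelP|apply/cokernelP].
Qed.

Lemma projective_lifting (p : Cat) : (forall M : lmodType R^c, exists (x : Cat)
    (u : {linear U x -> M}) (v : {linear M -> U x}), cancel u v /\ cancel v u) ->
  projective p -> lifting (U p).
Proof.
move=> repr pp A B ep f sep.
have [a [u [v [uK vK]]]] := repr A; have [b [u' [v' [u'K v'K]]]] := repr B.
have [|g gE] := pp a b (psi (lin_comp v' (lin_comp ep u))) (psi (lin_comp v' f)).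
  apply/epiP; rewrite psiK => y; have [x xE] := sep (u' y).
  by exists (v x); rewrite /lin_comp /= vK xE u'K.
exists (lin_comp u (phi g)) => x; apply: (can_inj v'K).
have := congr1 (fun h => phi h x) gE.
by rewrite phi_cmp !psiK.
Qed.

Lemma lifting_projective (p : Cat) : lifting (U p) -> projective p.
Proof.
move=> lp x y ep f /epiP sep; have [g gE] := lp _ _ _ (phi f) sep.
by exists (psi g); apply: phi_ext => a; rewrite phi_cmp psiK.
Qed.

Hypothesis ext_repr : forall (c a : Cat) (E : lmodType R^c) (i : {linear U a -> E})
    (p : {linear E -> U c}), ses i p ->
  exists (x : Cat) (u : {linear U x -> E}) (v : {linear E -> U x}),
    cancel u v /\ cancel v u.

Lemma ses_iso (A E C F : lmodType R^c) (i : {linear A -> E}) (p : {linear E -> C})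
    (u : {linear F -> E}) (v : {linear E -> F}) : cancel u v -> cancel v u ->
  @ses R A E C i p -> @ses R A F C (lin_comp v i) (lin_comp p u).
Proof.
move=> uK vK [inji sp ex]; split.
- by move=> x y /(can_inj vK) /inji.
- by move=> c; have [x <-] := sp c; exists (v x); rewrite /lin_comp /= vK.
- move=> x; rewrite /lin_comp /=; split=> [/ex [a aE]|[a <-]].
    by exists a; rewrite aE uK.
  by rewrite vK; apply/ex; exists a.
Qed.

(** An equivalence from the split extension transports its section. Conversely, a retraction of E
    and a section of E' assemble into a map E -> E'. *)
Lemma Ext1_zeroP (c a : Cat) : Ext1_zero c a <-> ext_split (U c) (U a).
Proof.
split=> [xz E i p sip|xs E E'].
  have [inl inlE] := @prod_map _ (U a) (U c) (U a) idfun \0.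
  have [inr inrE] := @prod_map _ (U a) (U c) (U c) \0 idfun.
  have sspl : ses inl (snd : {linear (U a * U c)%type -> U c}).
    split.
    - by move=> x y; rewrite !inlE => -[].
    - by move=> y; exists (0, y).
    - move=> [x y] /=; split=> [->|[z]]; first by exists x; rewrite inlE.
      by rewrite inlE => -[].
  have [x [u [v [uK vK]]]] := ext_repr sspl.
  have [x' [u' [v' [u'K v'K]]]] := ext_repr sip.
  have mk (y : Cat) (F : lmodType R^c) (j : {linear U a -> F}) q
      (w : {linear U y -> F}) (w' : {linear F -> U y}) :
      cancel w w' -> cancel w' w -> ses j q ->
      short_exact (psi (lin_comp w' j)) (psi (lin_comp q w)).
    by move=> wK w'K s; apply/short_exactP; rewrite !psiK; apply: ses_iso.
  have [h [hi hp]] := xz (Extension (mk _ _ _ _ _ _ _ uK vK sspl))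
    (Extension (mk _ _ _ _ _ _ _ u'K v'K sip)).
  rewrite /= in h hi hp.
  exists (lin_comp (lin_comp u' (phi h)) (lin_comp v inr)) => y.
  have := congr1 (fun k => phi k (v (inr y))) hp.
  by rewrite phi_cmp !psiK /lin_comp /= vK inrE.
have /short_exactP sE := ext_exact E; have /short_exactP sE' := ext_exact E'.
have [s sK] := xs _ _ _ sE; have [s' s'K] := xs _ _ _ sE'.
have [ret [retK retE]] := ses_retraction sE sK.
exists (psi (lin_comp (phi (ext_inj E')) ret \+ lin_comp s' (phi (ext_proj E)))).
have [_ _ exE] := sE; have [_ _ exE'] := sE'.
split; apply: phi_ext => x; rewrite phi_cmp psiK /= /lin_comp /=.
  rewrite retK; have -> : phi (ext_proj E) (phi (ext_inj E) x) = 0.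
    by apply/exE; exists x.
  by rewrite linear0 addr0.
rewrite linearD s'K; have -> : phi (ext_proj E') (phi (ext_inj E') (ret x)) = 0.
  by apply/exE'; exists (ret x).
by rewrite add0r.
Qed.

(** The complement of a retract is the cokernel of its inclusion. *)
Lemma summandP (s x : Cat) : summand s x <->
  exists (i : {linear U s -> U x}) (p : {linear U x -> U s}), forall a, p (i a) = a.
Proof.
split=> [[s' [inj univ]]|[i [p pK]]].
  have [h [hE _]] := univ s (fun b => if b return Defs.hom (if b then s else s') s
                                      then idm s else psi \0).
  exists (phi (inj true)), (phi h) => a.
  by rewrite -phi_cmp (hE true) phi_id.
have [s' [q [sq qE]]] := cokerP i.
have qi a : q (i a) = 0 by apply/qE; exists a.
have [|t tE] := @factor_surj _ _ _ _ q (idfun \- (i \o p)) sq.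
  by move=> b /qE [a <-]; rewrite /= pK subrr.
exists s', (fun b => if b return Defs.hom (if b then s else s') x then psi i else psi t).
move=> w g.
exists (psi (lin_comp (phi (g true)) p \+ lin_comp (phi (g false)) q)); split.
  case; apply: phi_ext => a; rewrite phi_cmp !psiK /= /lin_comp /=.
    by rewrite pK qi linear0 addr0.
  have [b <-] := sq a; by rewrite tE /= !linearB pK subrr add0r qi linear0 subr0.
move=> h hE; apply: phi_ext => y; rewrite psiK /= /lin_comp /=.
by rewrite -(hE true) -(hE false) !phi_cmp !psiK tE /= -linearD addrC subrK.
Qed.

(** Only objects of [Cat] test the universal property, so in mod-R it does not assert a direct sum
    of modules. *)
Definition copower_inj (I : Type) (v x : Cat) (inj : I -> {linear U v -> U x}) :=
  forall (w : Cat) (g : I -> {linear U v -> U w}),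
    exists! h : {linear U x -> U w}, forall i a, h (inj i a) = g i a.

Lemma is_copowerP (I : Type) (v x : Cat) : is_copower I v x <->
  exists inj : I -> {linear U v -> U x}, copower_inj inj.
Proof.
split=> [[inj univ]|[inj univ]].
  exists (fun i => phi (inj i)) => w g.
  have [h [hE hu]] := univ w (fun i => psi (g i)).
  exists (phi h); split=> [i a|h' h'E].
    by rewrite -phi_cmp hE psiK.
  rewrite -(psiK h'); congr phi; apply: hu => i; apply: phi_ext => a.
  by rewrite phi_cmp !psiK h'E.
exists (fun i => psi (inj i)) => w g.
have [h [hE hu]] := univ w (fun i => phi (g i)).
exists (psi h); split=> [i|h' h'E].
  by apply: phi_ext => a; rewrite phi_cmp !psiK hE.
rewrite -(phiK h'); congr psi; apply: hu => i a.
by rewrite -(h'E i) phi_cmp psiK.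
Qed.

End ConcreteCategory.

(** * The categories Mod-R and mod-R *)

Section Instances.
Variable R : pzRingType.
Local Notation fp M := (@finitely_presented R M).
Local Notation lin x y := {linear (sval x : lmodType R^c) -> (sval y : lmodType R^c)}.
Local Notation U := (fun x : fpMod R => sval x : lmodType R^c).

Definition fp_obj (M : lmodType R^c) (h : fp M) : fpMod R := exist _ (M : Mod R) h.

Lemma fp_coker (x y : fpMod R) (f : lin x y) : exists (z : fpMod R) (p : lin y z),
  surj p /\ forall b, p b = 0 <-> exists a, f a = b.
Proof.
have [C [p [sp pE]]] := cokernel_exists f.
by exists (fp_obj (fp_cokernel (fp_fg (svalP x)) (svalP y) sp pE)), p.
Qed.

Lemma fp_ext_repr (c a : fpMod R) (E : lmodType R^c) (i : {linear U a -> E})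
    (p : {linear E -> U c}) : ses i p ->
  exists (x : fpMod R) (u : {linear U x -> E}) (v : {linear E -> U x}),
    cancel u v /\ cancel v u.
Proof.
move=> sip; exists (fp_obj (fp_ext sip (svalP a) (svalP c))), idfun, idfun.
by split.
Qed.

Local Notation hom_lin := (fun (x y : fpMod R) (f : Defs.hom x y) => f : lin x y).
Local Notation lin_hom := (fun (x y : fpMod R) (f : lin x y) => f : Defs.hom x y).
Local Notation fp_reg := (fp_obj (@fp_regular R)).

Lemma fp_zero_morP (x y : fpMod R) (f : Defs.hom x y) :
  zero_mor f <-> forall a, (f : lin x y) a = 0.
Proof.
apply: (@zero_morP R (fpMod R) U hom_lin lin_hom _ _ _ _ fp_reg) => //.
exact: fp_coker.
Qed.

Lemma fp_monoP (x y : fpMod R) (f : Defs.hom x y) : mono f <-> injective (f : lin x y).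
Proof.
apply: (@monoP R (fpMod R) U hom_lin lin_hom _ _ _ fp_reg 1) => //.
- exact: regular_map.
- exact: regular_ext.
Qed.

Lemma fp_epiP (x y : fpMod R) (f : Defs.hom x y) : epi f <-> surj (f : lin x y).
Proof. by apply: (@epiP R (fpMod R) U hom_lin lin_hom) => //; exact: fp_coker. Qed.

Lemma fp_kernelP (x y k : fpMod R) (f : Defs.hom x y) (i : Defs.hom k x) :
  is_kernel f i <->
  injective (i : lin k x) /\
  forall b, (f : lin x y) b = 0 <-> exists a, (i : lin k x) a = b.
Proof.
apply: (@kernelP R (fpMod R) U hom_lin lin_hom _ _ _ _ fp_reg 1) => //.
- exact: fp_coker.
- exact: regular_map.
- exact: regular_ext.
Qed.

Lemma fp_cokernelP (x y c : fpMod R) (f : Defs.hom x y) (p : Defs.hom y c) :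
  is_cokernel f p <->
  surj (p : lin y c) /\ forall b, (p : lin y c) b = 0 <-> exists a, (f : lin x y) a = b.
Proof.
apply: (@cokernelP R (fpMod R) U hom_lin lin_hom _ _ _ _ fp_reg) => //.
exact: fp_coker.
Qed.

Lemma fp_Ext1_zeroP (c a : fpMod R) : Ext1_zero c a <-> ext_split (U c) (U a).
Proof.
apply: (@Ext1_zeroP R (fpMod R) U hom_lin lin_hom _ _ _ _ fp_reg 1) => //.
- exact: fp_coker.
- exact: regular_map.
- exact: regular_ext.
- exact: fp_ext_repr.
Qed.

Lemma fp_summandP (s x : fpMod R) : summand s x <->
  exists (i : lin s x) (p : lin x s), forall a, p (i a) = a.
Proof.
apply: (@summandP R (fpMod R) U hom_lin lin_hom) => //.
exact: fp_coker.
Qed.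

Definition fp_copower (I : Type) (v x : fpMod R) (inj : I -> lin v x) :=
  copower_inj (Cat := fpMod R) (U := U) inj.

Lemma fp_is_copowerP (I : Type) (v x : fpMod R) : is_copower I v x <->
  exists inj : I -> lin v x, fp_copower inj.
Proof. exact: (@is_copowerP R (fpMod R) U hom_lin lin_hom). Qed.

Local Notation UM := (fun x : Mod R => x : lmodType R^c).
Local Notation mlin x y := {linear (x : lmodType R^c) -> (y : lmodType R^c)}.
Local Notation mhom_lin := (fun (x y : Mod R) (f : Defs.hom x y) => f : mlin x y).
Local Notation mlin_hom := (fun (x y : Mod R) (f : mlin x y) => f : Defs.hom x y).

Lemma mod_zero_morP (x y : Mod R) (f : Defs.hom x y) :
  zero_mor f <-> forall a, (f : mlin x y) a = 0.
Proof.
apply: (@zero_morP R (Mod R) UM mhom_lin mlin_hom _ _ _ _ (@regular_module R)) => // *.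
exact: cokernel_exists.
Qed.

Lemma mod_epiP (x y : Mod R) (f : Defs.hom x y) : epi f <-> surj (f : mlin x y).
Proof.
apply: (@epiP R (Mod R) UM mhom_lin mlin_hom) => // *.
exact: cokernel_exists.
Qed.

Lemma mod_short_exactP (x y z : Mod R) (i : Defs.hom x y) (p : Defs.hom y z) :
  short_exact i p <-> ses (i : mlin x y) (p : mlin y z).
Proof.
apply: (@short_exactP R (Mod R) UM mhom_lin mlin_hom _ _ _ _
  (@regular_module R) 1) => // *.
- exact: cokernel_exists.
- exact: regular_map.
- exact: regular_ext.
Qed.

Lemma mod_Ext1_zeroP (c a : Mod R) : Ext1_zero c a <-> ext_split (c : lmodType R^c) a.
Proof.
apply: (@Ext1_zeroP R (Mod R) UM mhom_lin mlin_hom _ _ _ _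
  (@regular_module R) 1) => //.
- by move=> *; exact: cokernel_exists.
- by move=> *; exact: regular_map.
- by move=> *; exact: regular_ext.
- by move=> c' a' E *; exists E, idfun, idfun.
Qed.

Lemma mod_summandP (s x : Mod R) : summand s x <->
  exists (i : mlin s x) (p : mlin x s), forall a, p (i a) = a.
Proof.
apply: (@summandP R (Mod R) UM mhom_lin mlin_hom) => // *.
exact: cokernel_exists.
Qed.

Lemma mod_is_copowerP (I : Type) (v x : Mod R) : is_copower I v x <->
  exists inj : I -> mlin v x, copower_inj (Cat := Mod R) (U := UM) inj.
Proof. exact: (@is_copowerP R (Mod R) UM mhom_lin mlin_hom). Qed.

Lemma mod_projectiveP (p : Mod R) : projective p <-> lifting (p : lmodType R^c).
Proof.
split.
  apply: (@projective_lifting R (Mod R) UM mhom_lin mlin_hom) => //.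
    by move=> *; exact: cokernel_exists.
  by move=> M; exists M, idfun, idfun.
apply: (@lifting_projective R (Mod R) UM mhom_lin mlin_hom) => // *.
exact: cokernel_exists.
Qed.

End Instances.

(** * Tilting objects of mod-R *)

Section Main.
Variable R : pzRingType.
Local Notation fp M := (@finitely_presented R M).
Local Notation lin x y := {linear (sval x : lmodType R^c) -> (sval y : lmodType R^c)}.
Local Notation mlin x y := {linear (x : lmodType R^c) -> (y : lmodType R^c)}.
Local Notation md x := (sval x : lmodType R^c).
Implicit Types (V v : fpMod R) (K M N T Q W X Y Z : lmodType R^c).

(** Binary products are also coproducts in mod-R, so copowers over I and J combine into one over
    their disjoint union. *)
Lemma fp_copower_prod (I J : Type) v (x y : fpMod R)
    (f : I -> lin v x) (g : J -> lin v y) :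
  fp_copower f -> fp_copower g ->
  exists h : I + J -> lin v (fp_obj (fp_prod (svalP x) (svalP y))), fp_copower h.
Proof.
move=> uf ug.
have [inl inlE] := @prod_map _ (md x) (md y) (md x) idfun \0.
have [inr inrE] := @prod_map _ (md x) (md y) (md y) \0 idfun.
exists (fun k => match k with
  | Datatypes.inl i => lin_comp inl (f i) | Datatypes.inr j => lin_comp inr (g j) end).
move=> w k.
have [a [aE au]] := uf w (fun i => k (Datatypes.inl i)).
have [b [bE bu]] := ug w (fun j => k (Datatypes.inr j)).
exists (lin_comp a (fst : {linear (md x * md y)%type -> md x}) \+
        lin_comp b (snd : {linear (md x * md y)%type -> md y})); split.
  case=> [i|j] z; rewrite /= /lin_comp /= ?inlE ?inrE /= linear0.
    by rewrite addr0 aE.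
  by rewrite add0r bE.
move=> h hE; apply: linear_ext; apply/funext => -[z t].
have -> : a = lin_comp h inl by apply: au => i s; rewrite -(hE (Datatypes.inl i)).
have -> : b = lin_comp h inr by apply: bu => j s; rewrite -(hE (Datatypes.inr j)).
by rewrite /= /lin_comp /= inlE inrE -linearD /= pair_split.
Qed.

Lemma fp_copower_ext_split (I : Type) v (x : fpMod R) (f : I -> lin v x) X :
  fp_copower f -> fp X -> ext_split (md v) X -> ext_split (md x) X.
Proof.
(* No exactness of coproducts is needed: lifts of the coprojections to an
   extension E of x by X assemble into a section, as E is in mod-R. *)
move=> uf fX vX E i p sip.
have /choice[l lE] k : exists g : {linear md v -> E}, forall c, p (g c) = f k c.
  exact: ext_split_lift sip.
have [s [sE _]] := uf (fp_obj (fp_ext sip fX (svalP x))) l.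
have [h [_ hu]] := uf x f.
exists s => c; rewrite -[p _]/(lin_comp p s c) -(hu (lin_comp p s)).
  by rewrite (hu idfun).
by move=> k a; rewrite /lin_comp /= sE lE.
Qed.

(** The codiagonal retracts every coprojection, and there is one as I is inhabited. *)
Lemma fp_copower_retract (I : Type) v (x : fpMod R) (f : I -> lin v x) :
  inhabited I -> fp_copower f ->
  exists (i : lin v x) (p : lin x v), forall a, p (i a) = a.
Proof.
move=> [k] uf; have [p [pE _]] := uf v (fun=> idfun).
by exists (f k), p => a; rewrite pE.
Qed.

Lemma AddP V (x : fpMod R) : Add V x <->
  exists (I : Type) (c : fpMod R) (f : I -> lin V c) (i : lin x c) (p : lin c x),
  [/\ inhabited I, fp_copower f & forall a, p (i a) = a].
Proof.
split=> [[I [c [hI [/fp_is_copowerP [f uf] /fp_summandP [i [p pK]]]]]]|].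
  by exists I, c, f, i, p.
move=> [I [c [f [i [p [hI uf pK]]]]]]; exists I, c; split=> //.
by split; [apply/fp_is_copowerP; exists f|apply/fp_summandP; exists i, p].
Qed.

(** A summand of a copower is also a quotient of it, so copowers suffice. *)
Lemma GenP V (x : fpMod R) : Gen V x <->
  exists (I : Type) (c : fpMod R) (f : I -> lin V c) (p : lin c x),
  [/\ inhabited I, fp_copower f & surj p].
Proof.
split=> [[y [p [/AddP [I [c [f [i [q [hI uf qK]]]]]] /fp_epiP sp]]]|].
  exists I, c, f, (lin_comp p q); split=> // b.
  by have [a <-] := sp b; exists (i a); rewrite /lin_comp /= qK.
move=> [I [c [f [p [hI uf sp]]]]]; exists c, p; split; last exact/fp_epiP.
by apply/AddP; exists I, c, f, idfun, idfun.
Qed.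

Lemma Gen_surj V (x y : fpMod R) (p : lin x y) : surj p -> Gen V x -> Gen V y.
Proof.
move=> sp /GenP [I [c [f [q [hI uf sq]]]]]; apply/GenP.
exists I, c, f, (lin_comp p q); split=> // b.
by have [a <-] := sp b; have [d <-] := sq a; exists d.
Qed.

Lemma Add_Gen V (x : fpMod R) : Add V x -> Gen V x.
Proof. by move=> Ax; exists x, (idm x); split=> //; apply/fp_epiP => b; exists b. Qed.

Lemma Pres_Gen V (x : fpMod R) : Pres V x -> Gen V x.
Proof.
move=> [y1 [y [f [p [_ [Ay /fp_cokernelP [sp _]]]]]]].
by exists y, p; split=> //; apply/fp_epiP.
Qed.

(** * Torsion pairs generated by a module *)

Lemma quot_copowersP W M :
  @quot_copowers (Mod R) W M <-> in_gen W M.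
Proof.
split=> [[I [c [p [_ [/mod_is_copowerP [f uf] /mod_epiP sp]]]]]|gM].
  apply: in_gen_surj sp _.
  (* The projection modulo the trace vanishes on all coprojections, so it is zero and the trace is
     everything. *)
  have [Q [q [sq qE]]] := submod_quot (submod_trace W c).
  have [h [_ hu]] := uf Q (fun=> \0).
  have q0 : q = \0.
    have <- : h = q; last by apply: hu.
    by apply: hu => i a; apply/qE; exists [:: (f i, a)]; rewrite big_seq1.
  by move=> z; apply/qE; rewrite q0.
have [C [inj uC]] := copower_exists {linear W -> M} W.
have [p [pE _]] := uC M id.
exists {linear W -> M}, C, p; split; first by exists; exact: \0.
split; first by apply/mod_is_copowerP; exists inj.
apply/mod_epiP => z; have [s ->] := gM z.
exists (\sum_(u <- s) inj u.1 u.2); rewrite linear_sum.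
by apply: eq_bigr => u _; rewrite pE.
Qed.

Lemma perpP W M : @perp (Mod R) W M <-> forall f : {linear W -> M}, forall w, f w = 0.
Proof. by split=> h f; apply/mod_zero_morP/h. Qed.

Lemma in_gen_map0 W M N (f : {linear M -> N}) : in_gen W M ->
  (forall g : {linear W -> N}, forall w, g w = 0) -> forall z, f z = 0.
Proof.
move=> gM N0 z; have [s ->] := gM z; rewrite linear_sum big1 // => u _.
exact: (N0 (lin_comp f u.1)).
Qed.

(** The torsion part of M is the trace T of W. As Ext^1(W, T) = 0, a map W -> M/T lifts to M, where
    its image lies in T, so it is zero. *)
Lemma in_gen_torsion_pair W : (forall X, in_gen W X -> ext_split W X) ->
  torsion_pair (@quot_copowers (Mod R) W) (@perp (Mod R) W).
Proof.
move=> xW.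
have decomp M : exists (T Q : lmodType R^c) (t : {linear T -> M}) (q : {linear M -> Q}),
    [/\ ses t q, in_gen W T & forall f : {linear W -> Q}, forall w, f w = 0].
  have [T [t [injt tE]]] := submod_inj (submod_trace W M).
  have /choice[l lE] (f : {linear W -> M}) : exists g : {linear W -> T},
      forall w, t (g w) = f w.
    by apply: factor_inj => // w; apply/tE; exists [:: (f, w)]; rewrite big_seq1.
  have gT : in_gen W T.
    move=> z; have [s sE] := (tE (t z)).2 (ex_intro _ z erefl).
    exists [seq (l u.1, u.2) | u <- s]; apply: injt; rewrite sE big_map linear_sum.
    by apply: eq_bigr => u _; rewrite lE.
  have [Q [q stq]] := ses_cokernel injt; have [_ sq ex] := stq.
  exists T, Q, t, q; split=> // f w.
  have [g gE] := ext_split_lift f (xW _ gT) stq.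
  by rewrite -gE -(lE g); apply/ex; exists (l g w).
split=> [M|]; last split=> [N|M].
- split=> [/quot_copowersP gM N /perpP N0 f|M0].
    by apply/mod_zero_morP; exact: in_gen_map0.
  have [T [Q [t [q [[injt sq ex] gT Q0]]]]] := decomp M.
  apply/quot_copowersP; apply: (in_gen_surj (p := t)) gT => z; apply/ex.
  have /mod_zero_morP -> // := M0 Q ((perpP W Q).2 Q0) q.
- split=> [/perpP N0 M /quot_copowersP gM f|N0].
    by apply/mod_zero_morP; exact: in_gen_map0.
  apply/perpP => f; apply/mod_zero_morP/N0/quot_copowersP; exact: in_gen_refl.
- have [T [Q [t [q [stq gT Q0]]]]] := decomp M.
  exists T, Q, t, q; split; first exact/quot_copowersP.
  by split; [exact/perpP|apply/mod_short_exactP].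
Qed.

Lemma torsion_pair_ext (A : category) (T T' F F' : A -> Prop) :
  (forall x : A, T x <-> T' x) -> (forall x : A, F x <-> F' x) ->
  torsion_pair T F -> torsion_pair T' F'.
Proof.
move=> TT FF.
have -> : T' = T by apply/funext => x; apply/propext; split=> /TT.
by have -> : F' = F by apply/funext => x; apply/propext; split=> /FF.
Qed.

(** The universal property yields projections of a finite copower, and its uniqueness clause shows
    that the identity is the sum of their composites with the coprojections. *)
Lemma add_fin_in_add W M : @add_fin R W M -> in_add W M.
Proof.
move=> [n [C [/mod_is_copowerP [f uf] /mod_summandP [i [p pK]]]]].
apply: (in_add_retract pK).
have /choice[pr prE] (k : 'I_n) : exists g : {linear (C : lmodType R^c) -> W},
    forall l a, g (f l a) = if l == k then a else 0.
  have [g [gE _]] := uf W (fun l => if l == k then (idfun : {linear W -> W}) else \0).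
  by exists g => l a; rewrite gE; case: eqP.
exists [seq (pr k, f k) | k <- enum 'I_n] => x.
have [s sE] := sum_linear (enum 'I_n) (fun k => lin_comp (f k) (pr k)).
have [h [_ hu]] := uf C f.
transitivity (s x); last by rewrite sE [RHS]big_map.
have hid : h = idfun by apply: hu.
suff <- : h = s by rewrite hid.
apply: hu => k a; rewrite sE big_enum /= (bigD1 k) //= big1 ?addr0.
  by rewrite /lin_comp /= prE eqxx.
by move=> l lk; rewrite /lin_comp /= prE eq_sym (negPf lk) linear0.
Qed.

Lemma retract_add_fin W M (i : {linear M -> W}) (p : {linear W -> M}) :
  (forall x, p (i x) = x) -> @add_fin R W M.
Proof.
move=> pK; exists 1%N, W; split; last by apply/mod_summandP; exists i, p.
apply/mod_is_copowerP; exists (fun=> idfun) => N g; exists (g ord0).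
split=> [k a|h hE]; first by rewrite (ord1 k).
by apply: linear_ext; apply/funext => a; rewrite -(hE ord0).
Qed.

(** * The two implications *)

Section TiltingObjectToModule.
Hypothesis coh : right_coherent R.

Lemma coherent_kernel (A B : lmodType R^c) (f : {linear A -> B}) : fp A -> fp B ->
  exists K (k : {linear K -> A}),
    [/\ fp K, injective k & forall x : A, f x = 0 <-> exists a, k a = x].
Proof.
move=> fA fB; have [_ [_ [_ [ker _]]]] := coh.
have [k [i /fp_kernelP [inji ex]]] := ker (fp_obj fA) (fp_obj fB) f.
by exists (md k), i; split=> //; exact: svalP k.
Qed.

Lemma tilting_object_classical V : tilting_object V ->
  exists (I : Type) (VI : fpMod R), classical_tilting_coproduct V I VI.
Proof.
move=> [[F tF] [GP [GE emb]]].
(* Every object embeds in Gen V, so Gen V is the whole kernel of Ext^1(V, -) in mod-R. *)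
have genE (x : fpMod R) : Gen V x <-> ext_split (md V) (md x).
  rewrite GE fp_Ext1_zeroP; split=> [[]//|xV].
  by split=> //; exact: emb.
pose G M := exists h : fp M, Gen V (fp_obj h).
pose Ad M := exists h : fp M, Add V (fp_obj h).
have G_fp M : G M -> fp M by case.
have G_ext M : G M -> ext_split (md V) M by case=> h /genE.
have Gobj (x : fpMod R) : Gen V x -> G (md x).
  by case: x => M h Gx; exists h.
have AdV (c : fpMod R) :
    (exists (I : Type) (f : I -> lin V c), inhabited I /\ fp_copower f) ->
    forall M, G M -> ext_split (md c) M.
  move=> [I [f [_ uf]]] M GM.
  by apply: fp_copower_ext_split uf (G_fp _ GM) (G_ext _ GM).
have G_surj X Y (p : {linear X -> Y}) : surj p -> fp Y -> G X -> G Y.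
  move=> sp hY [hX GX]; exists hY.
  exact: (@Gen_surj V (fp_obj hX) (fp_obj hY) p).
have G_embed M : fp M -> exists T (t : {linear M -> T}), G T /\ injective t.
  move=> fM; have [y [i [Gy /fp_monoP inji]]] := emb (fp_obj fM).
  by exists (md y), i; split=> //; exact: Gobj.
have [||||||Y0 [Y1 [i [p [sip [fY0 AY0] [fY1 AY1]]]]]] :=
  @regular_coresolution R G Ad _ _ _ G_fp G_surj _ _ _ G_embed.
- by move=> Y [].
- by move=> Y [h /Add_Gen GY]; exists h.
- move=> Y Z i p pK [h /AddP [I [c [f [i' [p' [hI uf p'K]]]]]]].
  exists (fp_retract pK h); apply/AddP.
  exists I, c, f, (lin_comp i' i), (lin_comp p p'); split=> // a.
  by rewrite /lin_comp /= p'K pK.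
- move=> X Y [hX /genE xX] [hY /genE xY]; exists (fp_prod hX hY).
  by apply/genE; exact: ext_split_prod.
- move=> X [hX /GP [y1 [y0 [f [p [Ay1 [Ay0 /fp_cokernelP [sp ex]]]]]]]].
  (* The kernel of [p] is the image of y1, hence a quotient of an object of Add V and so in Gen
     V. *)
  have [K [k [fK injk kE]]] := coherent_kernel (p : lin y0 (fp_obj hX)) (svalP y0) hX.
  exists (md y0), K, k, p; split=> //.
    by case: y0 Ay0 {f p sp ex k injk kE} => M h Ay0; exists h.
  have [a|g gE] := @factor_inj R _ _ _ k (f : lin y1 y0) injk.
    by apply/kE/ex; exists a.
  exists fK; apply: (@Gen_surj V y1 (fp_obj fK) g) (Add_Gen Ay1) => z.
  have /ex [a aE] : (p : lin y0 (fp_obj hX)) (k z) = 0 by apply/kE; exists z.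
  by exists a; apply: injk; rewrite gE.
- move=> Y X [hY /AddP [I [c [f [i [p [hI uf pK]]]]]]] GX.
  by apply: ext_split_retract pK _; apply: AdV GX; exists I, f.
have [I0 [c0 [f0 [i0 [p0 [hI0 u0 p0K]]]]]] := (AddP _ _).1 AY0.
have [I1 [c1 [f1 [i1 [p1 [hI1 u1 p1K]]]]]] := (AddP _ _).1 AY1.
(* Combining the two index sets gives one coproduct with both terms of the coresolution as
   summands. *)
have [f uf] := fp_copower_prod u0 u1.
set c := fp_obj _ in f uf.
have hI : inhabited (I0 + I1) by case: hI0 => k; exists; left.
have GenVI : Gen V c.
  by apply/GenP; exists (I0 + I1)%type, c, f, idfun; split=> // b; exists b.
have xc : forall M, G M -> ext_split (md c) M by apply: AdV; exists (I0 + I1)%type, f.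
have [n [K [k [d [skd fgK lK]]]]] :=
  projective_resolution coherent_kernel G_fp G_surj G_embed (svalP c) xc.
have [a [b abK]] := fp_copower_retract hI uf.
have gen_ext X : in_gen (md c) X -> ext_split (md c) X.
  exact: in_gen_ext_split lK fgK (@free_lifting R n) skd (xc _ (Gobj _ GenVI)).
have add0 : add_fin (md c) Y0.
  have [inl inlE] := @prod_map _ (md c0) (md c1) (md c0) idfun \0.
  apply: (@retract_add_fin _ _ (lin_comp inl i0)
    (lin_comp p0 (fst : {linear (md c0 * md c1)%type -> md c0}))) => x.
  by rewrite /lin_comp /= inlE p0K.
have add1 : add_fin (md c) Y1.
  have [inr inrE] := @prod_map _ (md c0) (md c1) (md c1) \0 idfun.
  apply: (@retract_add_fin _ _ (lin_comp inr i1)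
    (lin_comp p1 (snd : {linear (md c0 * md c1)%type -> md c1}))) => x.
  by rewrite /lin_comp /= inrE p1K.
(* Both sides are the kernel of Ext^1 on mod-R; V is a retract of [c], which gives the converse. *)
have genP (x : fpMod R) : Gen V x <-> in_gen (md c) (md x).
  split=> [Gx|/gen_ext xcx].
    by apply: (ext_split_in_gen (add_fin_in_add add0) (add_fin_in_add add1) sip);
      exact/xc/Gobj.
  by apply/genE; apply: ext_split_retract abK xcx.
exists (I0 + I1)%type, c; split=> //; split.
  by apply/fp_is_copowerP; exists f.
split; [split; [|split]|split].
- exists K, ('rV[R^c]_n : lmodType R^c), k, d; split=> //.
  split; first exact/mod_projectiveP.
  split; first exact: fg_rV.
  split; first exact/mod_projectiveP/free_lifting.
  exact/mod_short_exactP.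
- exact/mod_Ext1_zeroP/xc/Gobj.
- exists Y0, Y1, i, p; split=> //; split=> //; exact/mod_short_exactP.
- exact: in_gen_torsion_pair.
(* The restricted pair is the given one: the torsion classes agree by [genP], and each torsion-free
   class is the right orthogonal. *)
have [_ [FP _]] := tF; apply: torsion_pair_ext tF => x.
  by rewrite genP /restrict_fp quot_copowersP.
rewrite FP; split=> [x0|/perpP x0 y /genP gy g].
  by apply/perpP => g; have /fp_zero_morP := x0 c GenVI g.
by apply/fp_zero_morP; apply: in_gen_map0 gy x0.
Qed.

Lemma classical_tilting_object V (I : Type) (VI : fpMod R) :
  classical_tilting_coproduct V I VI ->
  tilting_object V /\
  associated_torsion_pair V (restrict_fp (quot_copowers (fp_module VI)))
    (restrict_fp (perp (fp_module VI))).
Proof.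
move=> [hI [/fp_is_copowerP [f uf] [[pd [/mod_Ext1_zeroP xW core]] [_ tp]]]].
have [P1 [P0 [i [p [fg1 [/mod_projectiveP l1 [_ [/mod_projectiveP l0]]]]]]]] := pd.
move=> /mod_short_exactP sip.
have [W0 [W1 [j [q [/add_fin_in_add a0 [/add_fin_in_add a1]]]]]] := core.
move=> /mod_short_exactP sjq.
have gen_ext X : in_gen (md VI) X -> ext_split (md VI) X.
  exact: in_gen_ext_split l1 fg1 l0 sip xW.
have ext_gen X : ext_split (md VI) X -> in_gen (md VI) X.
  exact: ext_split_in_gen a0 a1 sjq X.
have [a [b abK]] := fp_copower_retract hI uf.
pose T := restrict_fp (@quot_copowers (Mod R) (md VI)).
have TP (x : fpMod R) : T x <-> in_gen (md VI) (md x) by exact: quot_copowersP.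
have [tpT _] := tp.
(* The restriction hypothesis enters here: a coproduct of copies of V in mod-R has only zero maps to
   torsion-free objects, V being a retract of VI, and is therefore torsion. *)
have T_copower (J : Type) (c : fpMod R) (g : J -> lin V c) : fp_copower g -> T c.
  move=> ug; apply/tpT => y /perpP y0 h; apply/fp_zero_morP => z.
  have [h0 [_ hu]] := ug y (fun=> \0).
  have <- : h0 = h.
    apply: hu => k w; rewrite -(abK w).
    exact: (y0 (lin_comp h (lin_comp (g k) b))).
  by have -> : h0 = \0 by apply: hu.
(* Finite powers of VI are again copowers of V, which turns quotients and retracts of such powers
   into members of Gen V and Add V. *)
pose cop (D : lmodType R^c) := exists (h : fp D) (J : Type)
  (g : J -> lin V (fp_obj h)), inhabited J /\ fp_copower g.
have cVI : cop (md VI) by case: (VI) f uf => M h f uf; exists h, I, f.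
have cprod A B : cop A -> cop B -> cop (A * B)%type.
  move=> [hA [J [g [[k] ug]]]] [hB [J' [g' [_ ug']]]].
  have [h uh] := fp_copower_prod ug ug'.
  by exists (fp_prod hA hB), (J + J')%type, h; split=> //; exists; left.
have GenT (x : fpMod R) : Gen V x <-> T x.
  split=> [/GenP [J [c [g [r [_ ug sr]]]]]|/TP gx].
    by apply/TP; apply: (in_gen_surj sr); apply/TP; apply: T_copower ug.
  have [D [d [[hD [J [g [hJ ug]]]] dE]]] :=
    in_gen_collect idfun cVI cprod (fp_fg (svalP x)) gx.
  by apply/GenP; exists J, (fp_obj hD), g, d.
split; last by split=> // x; rewrite GenT.
split; [|split; [|split]].
- exists (restrict_fp (perp (fp_module VI))).
  by apply: torsion_pair_ext tp => x; rewrite ?GenT.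
- move=> x; split=> [/GenT/TP gx|]; last exact: Pres_Gen.
  have [Q [K [k [d [[injk sd ex] aQ gK fK]]]]] :=
    in_gen_presentation coherent_kernel (svalP VI) gen_ext a0 a1 sjq (svalP x) gx.
  have fQ := fp_in_add (svalP VI) aQ.
  (* The kernel K is a quotient of a copower [c] of V, so [x] is the cokernel of the composite c ->
     K -> Q. *)
  have /GenT /GenP [J [c [g [r [hJ ug sr]]]]] : T (fp_obj fK) by apply/TP.
  exists c, (fp_obj fQ), (lin_comp k r), d; split; [|split].
  + by apply/AddP; exists J, c, g, idfun, idfun.
  + have [D [s [t [[hD [J' [g' [hJ' ug']]]] stK]]]] :=
      in_add_retract_of cVI cprod aQ.
    by apply/AddP; exists J', (fp_obj hD), g', s, t.
  + apply/fp_cokernelP; split=> // z; split=> [/ex [y <-]|[y <-]].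
      by have [w <-] := sr y; exists w.
    by apply/ex; exists (r y).
(* Vanishing of Ext^1 passes from VI to its retract V, and back from V to the coproduct VI. *)
- move=> x; split=> [Gx|[_ /fp_Ext1_zeroP xV]].
    split; first by exists x, (idm x); split=> //; apply/fp_monoP.
    apply/fp_Ext1_zeroP; apply: ext_split_retract abK _.
    exact/gen_ext/TP/GenT.
  apply/GenT/TP/ext_gen; exact: fp_copower_ext_split uf (svalP x) xV.
- move=> x; have [L [B [v [r [[injv _ _] _ gL fL]]]]] :=
    in_gen_embed (svalP VI) a0 a1 sjq (svalP x).
  exists (fp_obj fL), v; split; last exact/fp_monoP.
  exact/GenT/TP.
Qed.

End TiltingObjectToModule.
End Main.

Theorem corollary6p14 (R : pzRingType) (hR : right_coherent R) (V : fpMod R) :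
  (tilting_object V <->
   exists (I : Type) (VI : fpMod R), classical_tilting_coproduct V I VI) /\
  (forall (I : Type) (VI : fpMod R), classical_tilting_coproduct V I VI ->
   associated_torsion_pair V
     (restrict_fp (quot_copowers (fp_module VI)))
     (restrict_fp (perp (fp_module VI)))).
Proof.
split; last by move=> I VI /(classical_tilting_object hR) [].
split; first exact: tilting_object_classical.
by move=> [I [VI /(classical_tilting_object hR) []]].
Qed.
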